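(* Let $\{\alpha_n\}_{n=0}^{\infty}$ be complex numbers with $|\alpha_n|<1$, $n\ge0$, and let $\mu$ and $\{S_n\}$ be respectively the nontrivial probability measure on the unit circle $\mathcal{C}$ and the sequence of monic OPUC for which $\alpha_n$ are the Verblunsky coefficients, so that $\alpha_{n-1}=-\overline{S_n(0)}$, $n\ge0$ (in particular $\alpha_{-1}=-1$). With $\rho_0$ chosen such that $|\rho_0|=1$, $\rho_0\ne1$, let $\{\rho_n\}_{n=0}^{\infty}$ be given by $$\rho_n=\frac{\rho_{n-1}-\overline{\alpha}_{n-1}}{1-\rho_{n-1}\alpha_{n-1}},\qquad n\ge1.$$ Then the sequence $\{R_n(z)\}$ of para-orthogonal polynomials given by $R_0(z)=1$ and $$R_n(z)\prod_{k=0}^{n-1}\frac{1+\operatorname{Re}(\rho_k\alpha_{k-1})}{1+\overline{\rho}_k\overline{\alpha}_{k-1}}=zS_{n-1}(z)-\rho_{n-1}S_{n-1}^{*}(z),\qquad n\ge1,$$ satisfies the three term recurrence formula $$R_{n+1}(z)=\big[(1+ic_{n+1})z+(1-ic_{n+1})\big]R_n(z)-4d_{n+1}zR_{n-1}(z),\qquad n\ge1,$$ with $R_0(z)=1$ and $R_1(z)=(1+ic_1)z+(1-ic_1)$. Here the real sequence $\{c_n\}$ and the positive chain sequence $\{d_{n+1}\}_{n=1}^{\infty}=\{d_{1,n}\}_{n=1}^{\infty}$ are such that $$c_1=i\,\frac{\rho_0+1}{\rho_0-1},\qquad c_{n+1}=\frac{-\operatorname{Im}(\rho_n\alpha_{n-1})}{1+\operatorname{Re}(\rho_n\alpha_{n-1})}\quad\text{and}\quad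 d_{1,n}=(1-\mathfrak{m}_{n-1})\mathfrak{m}_n,\qquad n\ge1,$$ where $\{\mathfrak{m}_n\}_{n=0}^{\infty}$ is the minimal parameter sequence of $\{d_{1,n}\}_{n=1}^{\infty}$, given by $$\mathfrak{m}_n=\frac12\,\frac{1-|\rho_n\alpha_{n-1}|^2}{1+\operatorname{Re}(\rho_n\alpha_{n-1})},\qquad n\ge0.$$ Moreover, the measure $\mu$ is such that the integral $J=\int_{\mathcal{C}}\zeta(1-\zeta)^{-1}(\zeta-1)^{-1}\,d\mu(\zeta)$ exists if and only if there exists a $\rho_0$ ($|\rho_0|=1$, $\rho_0\ne1$) such that the corresponding positive chain sequence $\{d_{1,n}\}_{n=1}^{\infty}$ is not a SPPCS (single parameter positive chain sequence).
   Context: $\mathcal{C}=\{\zeta\in\mathbb{C}:|\zeta|=1\}$. A measure on $\mathcal{C}$ is nontrivial if its support is infinite. The monic orthogonal polynomials on the unit circle (OPUC) of $\mu$ are the monic polynomials $S_n$ of degree $n$ with $\int_{\mathcal{C}}\overline{S_m}S_n\,d\mu=0$ for $m\ne n$; $S_n^{*}(z)=z^n\overline{S_n(1/\bar z)}$. The Verblunsky coefficients are $\alpha_{n-1}=-\overline{S_n(0)}$, and $S_n(z)=zS_{n-1}(z)-\overline{\alpha}_{n-1}S_{n-1}^{*}(z)$, $n\ge1$; any sequence with $|\alpha_n|<1$, $n\ge0$, determines a unique nontrivial probability measure. Positive chain sequence: a sequence $\{a_n\}_{n=1}^{\infty}$ is a positive chain sequence if there is a parameter sequence $\{g_n\}_{n=0}^{\infty}$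 with $0\le g_0<1$, $0<g_n<1$ for $n\ge1$ and $a_n=(1-g_{n-1})g_n$ for $n\ge1$. The minimal parameter sequence is the one with $g_0=0$; the maximal parameter sequence is the one with largest $g_0$. A positive chain sequence is a SPPCS if its minimal and maximal parameter sequences coincide. On $\mathcal{C}\setminus\{1\}$, $\zeta(1-\zeta)^{-1}(\zeta-1)^{-1}=|\zeta-1|^{-2}$; ''$J$ exists'' means the integral is finite. *)

(* Defs.v *)
From HB Require Import structures.
From mathcomp Require Import all_boot all_order all_algebra.
From mathcomp Require Import all_classical all_reals all_analysis.
From mathcomp Require Import complex.
From mathcomp Require Import ring.
Set Implicit Arguments.
Unset Strict Implicit.
Unset Printing Implicit Defensive.
Import Order.TTheory GRing.Theory Num.Theory.
Import numFieldNormedType.Exports.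
Local Open Scope classical_set_scope.
Local Open Scope ring_scope.

(* The complex plane over [R] with its Borel sigma-algebra.  A measure on the
   unit circle is a measure on this space giving full mass to [circle]. *)
Notation borelC R := (g_sigma_algebraType (@open (R[i]^o))).

Section UnitCircle.
Variable R : realType.
Local Notation C := R[i].
Implicit Types (mu : probability (borelC R) R) (S : nat -> {poly C}).

Definition circle : set C := [set z | `|z| = 1].

Definition supp mu : set C :=
  [set z | forall U : set R[i]^o, open U -> U z -> (0 < mu U)%E].

Definition nontrivial_prob mu : Prop :=
  mu circle = 1%E /\ infinite_set (supp mu).

Definition circle_int mu (f : C -> C) : C :=
  (Rintegral mu circle (fun z => complex.Re (f z))
   +i* Rintegral mu circle (fun z => complex.Im (f z)))%C.

Definition monic_OPUC mu S : Prop :=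
  (forall n, S n \is monic /\ size (S n) = n.+1) /\
  (forall m n, m != n -> circle_int mu (fun z => (S m).[z]^* * (S n).[z]) = 0).

(* [revp n p] is z^n * conj (p (1 / conj z)), written on coefficients so that
   it is a polynomial; see [horner_revp]. *)
Definition revp (n : nat) (p : {poly C}) : {poly C} :=
  \poly_(i < n.+1) (p`_(n - i))^*.

Lemma horner_revp (n : nat) (p : {poly C}) (z : C) :
  (size p <= n.+1)%N -> z != 0 ->
  (revp n p).[z] = z ^+ n * (p.[1 / z^*])^*.
Proof.
move=> sp z0; rewrite /revp horner_poly (horner_coef_wide _ sp).
rewrite rmorph_sum mulr_sumr [LHS](reindex_inj rev_ord_inj) /=.
apply: eq_bigr => i _.
have ilen : (i <= n)%N by rewrite -ltnS.
rewrite !subSS subKn // div1r rmorphM rmorphXn fmorphV /= conjCK mulrCA.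
have -> : z ^+ n = z ^+ (n - i) * z ^+ i by rewrite -exprD subnK.
by rewrite -mulrA -exprMn mulfV // expr1n mulr1.
Qed.

(* [verblunsky alpha n] is the coefficient of index n-1, with the convention
   that the coefficient of index -1 is -1. *)
Definition verblunsky (alpha : nat -> C) (n : nat) : C :=
  if n is k.+1 then alpha k else -1.

Fixpoint rho (alpha : nat -> C) (rho0 : C) (n : nat) : C :=
  if n is k.+1 then
    (rho alpha rho0 k - (alpha k)^*) / (1 - rho alpha rho0 k * alpha k)
  else rho0.

(* Para-orthogonal polynomial of degree n >= 1: a nonzero multiple of
   z S_{n-1} - tau S_{n-1}^* for some unimodular tau. *)
Definition para_orthogonal S (n : nat) (P : {poly C}) : Prop :=
  exists kappa tau : C, [/\ kappa != 0, `|tau| = 1 &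
    P = kappa *: ('X * S n.-1 - tau *: revp n.-1 (S n.-1))].

(* zeta (1 - zeta)^-1 (zeta - 1)^-1; on the circle minus {1} it is the positive
   real number |zeta - 1|^-2, see [J_integrandE]. *)
Definition J_integrand (z : C) : C := z * (1 - z)^-1 * (z - 1)^-1.

Lemma J_integrandE (z : C) : circle z -> z != 1 ->
  J_integrand z = (`|z - 1| ^+ 2)^-1.
Proof.
rewrite /circle /= => z1 zn1.
have z0 : z != 0 by rewrite -normr_gt0 z1 ltr01.
have zJ : z^* = z^-1.
  by apply: (mulfI z0); rewrite -normCK z1 expr1n mulfV.
have h : z - 1 != 0 by rewrite subr_eq0.
rewrite /J_integrand normCK rmorphB rmorph1 /= zJ.
by field; rewrite z0 h mulN1r subr_eq0 eq_sym -subr_eq0 h.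
Qed.

(* The integral of the nonnegative function [J_integrand], whose value at the
   singularity 1 is +oo: an atom of mu at 1 makes the integral infinite. *)
Definition J mu : \bar R :=
  (\int[mu]_(z in circle)
     (if (z : C) == 1%R then +oo else (complex.Re (J_integrand z))%:E))%E.

Definition J_exists mu : Prop := (J mu < +oo)%E.

End UnitCircle.

Section ChainSequences.
Variable R : realType.
Implicit Types a g m : nat -> R.

(* Chain sequences are indexed from 1 (the value [a 0] is irrelevant),
   parameter sequences from 0. *)
Definition parameter_seq a g : Prop :=
  [/\ 0 <= g 0%N < 1,
      forall n, (1 <= n)%N -> 0 < g n < 1 &
      forall n, (1 <= n)%N -> a n = (1 - g n.-1) * g n].

Definition positive_chain_seq a : Prop := exists g, parameter_seq a g.

Definition minimal_parameter_seq a m : Prop :=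
  parameter_seq a m /\ m 0%N = 0.

Definition maximal_parameter_seq a m : Prop :=
  parameter_seq a m /\ (forall g, parameter_seq a g -> g 0%N <= m 0%N).

Definition SPPCS a : Prop :=
  positive_chain_seq a /\
  exists2 m, minimal_parameter_seq a m & maximal_parameter_seq a m.

End ChainSequences.

Section Coefficients.
Variable R : realType.
Variables (alpha : nat -> R[i]) (rho0 : R[i]).
Local Notation w n := (rho alpha rho0 n * verblunsky alpha n).

Definition mpar (n : nat) : R :=
  2^-1 * ((1 - ComplexField.Normc.normc (w n) ^+ 2) / (1 + complex.Re (w n))).

(* the sequence d_{1,n}, n >= 1 *)
Definition d1 (n : nat) : R := (1 - mpar n.-1) * mpar n.

End Coefficients.

(* Main.v *)
Require Import Defs.
From HB Require Import structures.
From mathcomp Require Import all_boot all_order all_algebra.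
From mathcomp Require Import all_classical all_reals all_analysis.
From mathcomp Require Import measurable_realfun.
From mathcomp Require Import complex ring.
Set Implicit Arguments.
Unset Strict Implicit.
Unset Printing Implicit Defensive.
Import Order.TTheory GRing.Theory Num.Theory.
Import numFieldNormedType.Exports.
Local Open Scope ring_scope.
Local Open Scope complex_scope.

(* Orthogonality and infinite support give the Szego recurrence, and the
   three-term recurrence is then elimination, using the second expression
   [(1 + w_n) Q_n = S_n - rho_n S_n^*] of [Q_n = z S_{n-1} - rho_{n-1} S_{n-1}^*],
   where [w_n = rho_n alpha_{n-1}].

   For the last part, put [r_n = m_n / (1 - m_n)].  By Wall's criterion the chain
   sequence is not a SPPCS iff [sum_n r_1 ... r_n] converges.  If [(u_n, v_n)]
   solves the Szego recurrence at [z = 1], [u_0 = rho_0 v_0], then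
   [u_n = rho_n v_n] and [r_1 ... r_n] is proportional to [|v_n|^2 / ||S_n||^2],
   so the question is whether some such solution, with [u_0 <> v_0], is square
   summable after normalization.
   If [J] is finite, the moments of [1 / (z - 1)] against [z S_n] and [S_n^*] form
   such a solution, and Bessel's inequality bounds the sum.
   Conversely, normalize [u_0 - v_0 = 1] and let
   [H_n = sum_(k < n) conj(u_k) S_k / ||S_k||^2].  A Christoffel-Darboux identity
   gives [(1 - z) H_n = 1 + G_n] with [||G_n|| -> 0] along a subsequence while
   [||H_n||] stays bounded, so [1 / (|1 - z|^2 + d) <= 2 |H_n|^2 + 2 |G_n|^2 / d]
   bounds the integral of the left-hand side uniformly in [d > 0], and [d -> 0]
   yields [J < oo]. *)

(** * Integration on the unit circle *)

Section CircleIntegral.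
Variable R : realType.
Local Notation C := R[i].
Local Notation unit_circle := (@circle R : set (borelC R)).
Local Open Scope classical_set_scope.

Lemma Re_le_norm (z : C) : `|complex.Re z|%:C <= `|z|.
Proof.
case: z => a b /=; rewrite lecR -sqrtr_sqr ler_sqrt ?addr_ge0 ?sqr_ge0 //.
by rewrite lerDl sqr_ge0.
Qed.

Lemma Im_le_norm (z : C) : `|complex.Im z|%:C <= `|z|.
Proof.
case: z => a b /=; rewrite lecR -sqrtr_sqr ler_sqrt ?addr_ge0 ?sqr_ge0 //.
by rewrite lerDr sqr_ge0.
Qed.

(** Stated for any additive real form dominated by the modulus, so that [Re] and [Im] are handled
    together: the ball of radius [f z - x] about [z] stays in the half-plane. *)
Lemma open_halfplane (f : C -> R) (x : R) :
    (forall z w, f (z - w) = f z - f w) ->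
    (forall z, `|f z|%:C <= `|z|) ->
  open ([set z | x < f z] : set R[i]^o).
Proof.
move=> fB fle; rewrite openE => z /= xz.
apply/nbhs_ballP; exists (f z - x)%:C; first by rewrite /= ltcR subr_gt0.
move=> w; rewrite -ball_normE /= => zw.
have := le_lt_trans (fle _) zw; rewrite ltcR fB.
by move=> /(le_lt_trans (ler_norm _)); rewrite ltrD2l ltrN2.
Qed.

Lemma measurable_linear_form (f : C -> R) :
    (forall z w, f (z - w) = f z - f w) ->
    (forall z, `|f z|%:C <= `|z|) ->
  measurable_fun setT (f : borelC R -> R).
Proof.
move=> fB fle.
apply: (measurability _ (measurable_realfun.RGenOInfty.measurableE R)).
move=> _ [_ [x ->]] <-.
rewrite setTI; apply: sub_sigma_algebra => /=.
rewrite (_ : _ @^-1` _ = [set z | x < f z]); first exact: open_halfplane.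
by apply/seteqP; split => z /=; rewrite in_itv /= andbT.
Qed.

Lemma measurable_Re : measurable_fun setT (@complex.Re R : borelC R -> R).
Proof.
by apply: measurable_linear_form => [[a b] [c d]|] //; exact: Re_le_norm.
Qed.

Lemma measurable_Im : measurable_fun setT (@complex.Im R : borelC R -> R).
Proof.
by apply: measurable_linear_form => [[a b] [c d]|] //; exact: Im_le_norm.
Qed.

Lemma measurable_circle : measurable unit_circle.
Proof.
have mn : measurable_fun setT
    (fun z : borelC R => complex.Re z ^+ 2 + complex.Im z ^+ 2).
  by apply: measurable_funD; apply: measurable_funX;
    [exact: measurable_Re|exact: measurable_Im].
have := mn measurableT _ (measurable_set1 (1 : R)); rewrite setTI.
congr measurable; apply/seteqP; split => -[a b]; rewrite /circle /=.
  by move=> e; rewrite -[`|_|]/((Num.sqrt (a ^+ 2 + b ^+ 2))%:C) e sqrtr1.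
rewrite -[`|_|]/((Num.sqrt (a ^+ 2 + b ^+ 2))%:C).
case=> /(congr1 (fun x => x ^+ 2)).
by rewrite sqr_sqrtr ?addr_ge0 ?sqr_ge0 // expr1n.
Qed.

(** Componentwise, to match [circle_int], and only on the circle, its domain of integration. *)
Definition cmeasurable (f : C -> C) : Prop :=
  measurable_fun unit_circle (fun z => complex.Re (f z)) /\
  measurable_fun unit_circle (fun z => complex.Im (f z)).

Lemma ReD (z w : C) : complex.Re (z + w) = complex.Re z + complex.Re w.
Proof. by case: z w => [a b] []. Qed.
Lemma ImD (z w : C) : complex.Im (z + w) = complex.Im z + complex.Im w.
Proof. by case: z w => [a b] []. Qed.
Lemma ReM (z w : C) : complex.Re (z * w) =
  complex.Re z * complex.Re w - complex.Im z * complex.Im w.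
Proof. by case: z w => [a b] []. Qed.
Lemma ImM (z w : C) : complex.Im (z * w) =
  complex.Re z * complex.Im w + complex.Im z * complex.Re w.
Proof. by case: z w => [a b] []. Qed.
Lemma Re_conj (z : C) : complex.Re (z^*)%R = complex.Re z.
Proof. by case: z. Qed.
Lemma Im_conj (z : C) : complex.Im (z^*)%R = - complex.Im z.
Proof. by case: z. Qed.

Lemma cmeasurable_cst (c : C) : cmeasurable (fun=> c).
Proof. by split; exact: measurable_cst. Qed.

Lemma cmeasurable_id : cmeasurable (fun z => z).
Proof.
by split; apply: measurable_funTS; [exact: measurable_Re|exact: measurable_Im].
Qed.

Lemma cmeasurableD f g : cmeasurable f -> cmeasurable g ->
  cmeasurable (fun z => f z + g z).
Proof.
move=> [f1 f2] [g1 g2]; split.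
- by under eq_fun do rewrite ReD; exact: measurable_funD.
- by under eq_fun do rewrite ImD; exact: measurable_funD.
Qed.

Lemma cmeasurableM f g : cmeasurable f -> cmeasurable g ->
  cmeasurable (fun z => f z * g z).
Proof.
move=> [f1 f2] [g1 g2]; split.
- under eq_fun do rewrite ReM.
  by apply: measurable_funB; exact: measurable_funM.
- under eq_fun do rewrite ImM.
  by apply: measurable_funD; exact: measurable_funM.
Qed.

Lemma cmeasurable_conj f : cmeasurable f -> cmeasurable (fun z => (f z)^*%R).
Proof.
move=> [f1 f2]; split; first by under eq_fun do rewrite Re_conj.
by under eq_fun do rewrite Im_conj; exact: measurable_funN.
Qed.

Lemma cmeasurableV f : cmeasurable f -> cmeasurable (fun z => (f z)^-1).
Proof.
move=> [f1 f2].
pose n (z : borelC R) := complex.Re (f z) ^+ 2 + complex.Im (f z) ^+ 2.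
have mn : measurable_fun unit_circle (fun z => (n z)^-1).
  (* Inverse and power [-1] both send 0 to 0, so they agree on all nonnegative numbers and zeros of
     [f] need not be excluded. *)
  have -> : (fun z => (n z)^-1) = (fun z => n z `^ (-1)).
    by apply/funext => z; rewrite powR_inv1 // addr_ge0 ?sqr_ge0.
  apply: (@measurableT_comp _ _ _ _ _ _ (fun x : R => x `^ (-1)) unit_circle n).
    exact: measurable_powR.
  by apply: measurable_funD; exact: measurable_funX.
split.
- rewrite (_ : (fun z => _) = (fun z => complex.Re (f z) * (n z)^-1)).
    exact: measurable_funM.
  by apply/funext => z; rewrite /n; case: (f z).
- rewrite (_ : (fun z => _) = (fun z => - (complex.Im (f z) * (n z)^-1))).
    by apply: measurable_funN; exact: measurable_funM.
  by apply/funext => z; rewrite /n; case: (f z).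
Qed.

Lemma cmeasurable_horner (p : {poly C}) : cmeasurable (fun z => p.[z]).
Proof.
elim/poly_ind: p => [|p c ih].
  by under eq_fun do rewrite horner0; exact: cmeasurable_cst.
under eq_fun do rewrite !hornerE.
apply: cmeasurableD; last exact: cmeasurable_cst.
by apply: cmeasurableM => //; exact: cmeasurable_id.
Qed.

Variable mu : probability (borelC R) R.

Definition cintegrable (f : C -> C) : Prop :=
  mu.-integrable unit_circle (fun z => (complex.Re (f z))%:E) /\
  mu.-integrable unit_circle (fun z => (complex.Im (f z))%:E).

Lemma cintegrableD f g : cintegrable f -> cintegrable g ->
  cintegrable (fun z => f z + g z).
Proof.
move=> [f1 f2] [g1 g2]; split.
- under eq_fun do rewrite ReD EFinD.
  exact: (integrableD measurable_circle).
- under eq_fun do rewrite ImD EFinD.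
  exact: (integrableD measurable_circle).
Qed.

Lemma cintegrableZ c f : cintegrable f -> cintegrable (fun z => c * f z).
Proof.
move=> [f1 f2]; split.
- under eq_fun do rewrite ReM EFinB !EFinM.
  by apply: (integrableB measurable_circle);
    apply: (integrableZl measurable_circle).
- under eq_fun do rewrite ImM EFinD !EFinM.
  by apply: (integrableD measurable_circle);
    apply: (integrableZl measurable_circle).
Qed.

(** The order on [C] compares only numbers with equal imaginary parts, so the bound forces [g] to be
    real and nonnegative on the circle; both components of [f] are then dominated by [Re g]. *)
Lemma le_cintegrable f g : cmeasurable f -> cintegrable g ->
  (forall z, circle z -> `|f z| <= g z) -> cintegrable f.
Proof.
move=> [f1 f2] [g1 _] fg; split;
  (apply: (le_integrable measurable_circle _ _ g1);
    [exact/measurable_EFinP|move=> z /fg]);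
  rewrite !abse_EFin lee_fin -lecR => h.
- apply: (le_trans (Re_le_norm _)); apply: (le_trans h).
  have := normr_ge0 (f z); move/le_trans/(_ h); case: (g z) => a b.
  by rewrite !lecE /= => /andP[/eqP -> _]; rewrite eqxx ler_norm.
- apply: (le_trans (Im_le_norm _)); apply: (le_trans h).
  have := normr_ge0 (f z); move/le_trans/(_ h); case: (g z) => a b.
  by rewrite !lecE /= => /andP[/eqP -> _]; rewrite eqxx ler_norm.
Qed.

Lemma cintegrable_cst c : cintegrable (fun=> c).
Proof.
by split; apply: (finite_measure_integrable_cst mu); exact: measurable_circle.
Qed.

Lemma horner_circle_bounded (p : {poly C}) (z : C) : circle z ->
  `|p.[z]| <= \sum_(i < size p) `|p`_i|.
Proof.
move=> z1; rewrite horner_coef; apply: (le_trans (ler_norm_sum _ _ _)).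
by apply: ler_sum => i _; rewrite normrM normrX z1 expr1n mulr1.
Qed.

Lemma circle_intD f g : cintegrable f -> cintegrable g ->
  circle_int mu (fun z => f z + g z) = circle_int mu f + circle_int mu g.
Proof.
move=> [f1 f2] [g1 g2]; rewrite /circle_int; simpc; congr (_ +i* _).
- under eq_fun do rewrite ReD.
  by apply: RintegralD => //; exact: measurable_circle.
- under eq_fun do rewrite ImD.
  by apply: RintegralD => //; exact: measurable_circle.
Qed.

Lemma circle_intZ c f : cintegrable f ->
  circle_int mu (fun z => c * f z) = c * circle_int mu f.
Proof.
have mc := measurable_circle.
have iZ (k : R) (h : borelC R -> R) :
    mu.-integrable unit_circle (fun z => (h z)%:E) ->
    mu.-integrable unit_circle (EFin \o (fun z => k * h z)).
  by move=> ih; exact: (integrableZl mc k ih).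
move=> [f1 f2]; rewrite /circle_int; case: c => a b; simpc; congr (_ +i* _).
- under eq_fun do rewrite ReM.
  by rewrite RintegralB //=; [rewrite !RintegralZl|exact: iZ|exact: iZ].
- under eq_fun do rewrite ImM.
  by rewrite RintegralD //=; [rewrite !RintegralZl|exact: iZ|exact: iZ].
Qed.

Lemma circle_int_conj f : cintegrable f ->
  circle_int mu (fun z => (f z)^*%R) = (circle_int mu f)^*%R.
Proof.
move=> [f1 f2]; rewrite /circle_int; simpc; congr (_ +i* _).
  by under eq_fun do rewrite Re_conj.
under eq_fun do rewrite Im_conj -mulN1r.
by rewrite RintegralZl ?mulN1r //; exact: measurable_circle.
Qed.

Lemma eq_circle_int f g : (forall z, circle z -> f z = g z) ->
  circle_int mu f = circle_int mu g.
Proof.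
move=> fg; rewrite /circle_int; congr (_ +i* _);
  by apply: eq_Rintegral => z; rewrite inE => /fg ->.
Qed.

Lemma circle_int_ge0 f : (forall z, circle z -> 0 <= f z) ->
  0 <= circle_int mu f.
Proof.
move=> f0; rewrite /circle_int lecE /=; apply/andP; split; last first.
  by apply: Rintegral_ge0 => z /f0; rewrite lecE => /andP[].
rewrite (_ : Rintegral _ _ _ = Rintegral mu unit_circle (fun=> 0)).
  by rewrite Rintegral_cst ?mul0r //; exact: measurable_circle.
by apply: eq_Rintegral => z; rewrite inE => /f0; rewrite lecE => /andP[/eqP].
Qed.

Lemma cintegrable_sum (I : Type) (r : seq I) (F : I -> C -> C) :
  (forall i, cintegrable (F i)) -> cintegrable (fun z => \sum_(i <- r) F i z).
Proof.
move=> iF; elim: r => [|i r ih].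
  by under eq_fun do rewrite big_nil; exact: cintegrable_cst.
by under eq_fun do rewrite big_cons; exact: cintegrableD.
Qed.

Lemma circle_int_sum (I : Type) (r : seq I) (F : I -> C -> C) :
  (forall i, cintegrable (F i)) ->
  circle_int mu (fun z => \sum_(i <- r) F i z) =
    \sum_(i <- r) circle_int mu (F i).
Proof.
move=> iF; elim: r => [|i r ih].
  under eq_fun do rewrite big_nil.
  rewrite big_nil /circle_int !Rintegral_cst ?mul0r //; exact: measurable_circle.
under eq_fun do rewrite big_cons.
by rewrite circle_intD // ?ih ?big_cons //; exact: cintegrable_sum.
Qed.

Hypothesis mu1 : mu unit_circle = 1%E.

Lemma circle_int_cst c : circle_int mu (fun=> c) = c.
Proof.
rewrite /circle_int !Rintegral_cst ?mu1 ?mulr1 /=; last 2 first.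
- exact: measurable_circle.
- exact: measurable_circle.
by rewrite mu1 /= !mulr1; case: c.
Qed.

Lemma le_circle_int f g : cintegrable f -> cintegrable g ->
  (forall z, circle z -> f z <= g z) -> circle_int mu f <= circle_int mu g.
Proof.
move=> fi gi fg; rewrite -subr_ge0.
have -> : circle_int mu g - circle_int mu f =
    circle_int mu (fun z => g z + -1 * f z).
  by rewrite circle_intD ?circle_intZ ?mulN1r //; exact: cintegrableZ.
by apply: circle_int_ge0 => z /fg; rewrite mulN1r subr_ge0.
Qed.

End CircleIntegral.

(** * Square-integrable functions and polynomials of zero norm *)

Section SquareIntegrable.
Variable R : realType.
Local Notation C := R[i].
Local Notation unit_circle := (@circle R : set (borelC R)).
Local Open Scope classical_set_scope.
Variable mu : probability (borelC R) R.

Definition square_integrable (f : C -> C) : Prop :=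
  cmeasurable f /\ cintegrable mu (fun z => `|f z| ^+ 2).

Lemma ge0_complex_Re_eq0 (x : C) : complex.Re x = 0 -> 0 <= x -> x = 0.
Proof. by case: x => a b /= ->; rewrite lecE /= => /andP[/eqP -> _]. Qed.

Lemma square_integrable_conj f :
  square_integrable f -> square_integrable (fun z => (f z)^*%R).
Proof.
move=> [mf sf]; split; first exact: cmeasurable_conj.
by under eq_fun do rewrite norm_conjC.
Qed.

Lemma cmeasurable_normsq (f : C -> C) : cmeasurable f ->
  cmeasurable (fun z => `|f z| ^+ 2).
Proof.
move=> mf; under eq_fun do rewrite normCK.
by apply: cmeasurableM => //; exact: cmeasurable_conj.
Qed.

Lemma square_integrable_bounded (f : C -> C) (M : C) : cmeasurable f ->
  (forall z, circle z -> `|f z| <= M) -> square_integrable f.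
Proof.
move=> mf fM; split=> //.
apply: (le_cintegrable (cmeasurable_normsq mf) (cintegrable_cst mu (M ^+ 2))).
move=> z /fM h; rewrite normrX normr_id.
by rewrite ler_pXn2r ?nnegrE ?normr_ge0 // (le_trans (normr_ge0 (f z))).
Qed.

Lemma square_integrable_horner (p : {poly C}) :
  square_integrable (fun z => p.[z]).
Proof.
apply: square_integrable_bounded (cmeasurable_horner p) _ => z.
exact: horner_circle_bounded.
Qed.

Lemma square_integrableM f g : square_integrable f -> square_integrable g ->
  cintegrable mu (fun z => f z * g z).
Proof.
move=> [mf sf] [mg sg].
apply: (le_cintegrable (cmeasurableM mf mg) (cintegrableD sf sg)) => z _.
have xy0 : 0 <= `|f z| * `|g z| by rewrite mulr_ge0.
have : 0 <= (`|f z| - `|g z|) ^+ 2.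
  by rewrite -realEsqr rpredB // normr_real.
rewrite normrM sqrrB addrAC subr_ge0; apply: le_trans.
by rewrite mulr2n lerDl.
Qed.

(** The parallelogram law with one term dropped. *)
Lemma le_normsqD (x y : C) : `|x + y| ^+ 2 <= 2 * `|x| ^+ 2 + 2 * `|y| ^+ 2.
Proof.
rewrite -subr_ge0 (_ : _ - _ = `|x - y| ^+ 2) ?exprn_ge0 //.
by rewrite !normCK !rmorphD rmorphN /=; ring.
Qed.

Lemma square_integrableD f g : square_integrable f -> square_integrable g ->
  square_integrable (fun z => f z + g z).
Proof.
move=> [mf sf] [mg sg]; have mfg := cmeasurableD mf mg; split=> //.
apply: (le_cintegrable (cmeasurable_normsq mfg)
  (cintegrableD (cintegrableZ 2 sf) (cintegrableZ 2 sg))) => z _.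
by rewrite ger0_norm ?exprn_ge0 // le_normsqD.
Qed.

(** A zero integral makes [p] vanish almost everywhere. If [p] were nonzero, the complement of its
    finite zero set would be open and null, so the support would lie in that finite set. *)
Lemma infinite_supp_circle_int_eq0 (p : {poly C}) :
  mu unit_circle = 1%E -> infinite_set (supp mu) ->
  circle_int mu (fun z => `|p.[z]| ^+ 2) = 0 -> p = 0.
Proof.
move=> mu1 infs ip0; apply/eqP; apply: contrapT => /negP pn0; apply: infs.
have [mp [ip _]] := square_integrable_horner p.
have mc := @measurable_circle R.
pose F (z : borelC R) : \bar R := (complex.Re (`|(p.[z] : C)| ^+ 2))%:E.
have intF0 : (\int[mu]_(z in unit_circle) `|F z| = 0)%E.
  rewrite (eq_integral F) => [|z _]; last first.
    rewrite /F gee0_abs // lee_fin.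
    by have := exprn_ge0 2 (normr_ge0 p.[z]); rewrite lecE => /andP[].
  move: ip0; rewrite /circle_int => -[+ _].
  by rewrite /Rintegral => h; rewrite -[LHS]fineK ?h //; exact: integrable_fin_num.
have mF : measurable_fun unit_circle F by exact: measurable_int ip.
have /(_ intF0) F0 := (ae_eq_integral_abs mu mc mF).1.
pose Z := [set z : C | p.[z] == 0].
have finZ : finite_set Z.
  apply: contrapT => /(infinite_set_fset (size p))[A AZ] szA.
  have rA : all (root p) (finmap.enum_fset A).
    by apply/allP => z zA; rewrite rootE; exact: (AZ z).
  have := max_poly_roots pn0 rA (finmap.fset_uniq A).
  by rewrite ltnNge szA.
apply: (sub_finite_set _ finZ) => z /= supz; apply: contrapT => /negP pz.
have oZ : open (~` Z : set R[i]^o).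
  have aC : accessible_space (R[i]^o).
    by apply: hausdorff_accessible; exact: norm_hausdorff.
  have [/(_ aC) fc _] :=
    @accessible_finite_set_closed (R[i]^o : topologicalType).
  by apply: closed_openC; exact: fc.
have := supz _ oZ; rewrite /Z /= => /(_ (negP pz)).
have mZ : measurable (~` Z : set (borelC R)) by exact: sub_sigma_algebra.
rewrite lt0e => /andP[/eqP + _]; apply.
apply/eqP; rewrite eq_le measure_ge0 andbT.
(* The measure lives on the whole plane. The part of this set on the circle is null because [p]
   vanishes almost everywhere there, the part off the circle because the circle has full mass. *)
have -> : (~` Z : set (borelC R)) =
    (unit_circle `&` ~` Z) `|` (~` unit_circle `&` ~` Z).
  by rewrite -setIUl setUv setTI.
have mcC : measurable (~` unit_circle) by exact: measurableC.
apply: (le_trans (measureU2 _ _ _)); [exact: measurableI..|].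
have e1 : mu (unit_circle `&` ~` Z) = 0%E.
  apply: (measure_negligible (measurableI _ _ mc mZ)).
  apply: negligibleS F0 => w /= [w1 pw] h; apply: pw.
  have Re0 : complex.Re (`|(p.[w] : C)| ^+ 2) = 0 by case: (h w1).
  have /eqP := ge0_complex_Re_eq0 Re0 (exprn_ge0 2 (normr_ge0 p.[w])).
  by rewrite sqrf_eq0 normr_eq0.
have e2 : (mu (~` unit_circle `&` ~` Z) <= 0)%E.
  have <- : mu (~` unit_circle) = 0%E by rewrite probability_setC // mu1 subee.
  by apply: le_measure; rewrite ?inE //; exact: measurableI.
rewrite -[leRHS]adde0; apply: leeD => //.
by rewrite -[leRHS]e1.
Qed.

End SquareIntegrable.

(** * Szego recurrence *)

Section InnerProduct.
Variable R : realType.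
Local Notation C := R[i].
Variable mu : probability (borelC R) R.

Definition inner (f g : C -> C) : C :=
  circle_int mu (fun z => (f z)^*%R * g z).

Lemma inner_conj f g : square_integrable mu f -> square_integrable mu g ->
  (inner f g)^*%R = inner g f.
Proof.
move=> sf sg; rewrite /inner -circle_int_conj; last first.
  by apply: square_integrableM => //; exact: square_integrable_conj.
by apply: eq_circle_int => z _; rewrite rmorphM /= conjCK mulrC.
Qed.

Lemma innerDr f g h : square_integrable mu f -> square_integrable mu g ->
  square_integrable mu h -> inner f (fun z => g z + h z) = inner f g + inner f h.
Proof.
move=> sf sg sh; have sf' := square_integrable_conj sf.
rewrite /inner -circle_intD; [|exact: square_integrableM..].
by apply: eq_circle_int => z _; rewrite mulrDr.
Qed.

Lemma innerZr c f g : square_integrable mu f -> square_integrable mu g ->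
  inner f (fun z => c * g z) = c * inner f g.
Proof.
move=> sf sg; have sf' := square_integrable_conj sf.
rewrite /inner -circle_intZ; last exact: square_integrableM.
by apply: eq_circle_int => z _; rewrite mulrCA.
Qed.

Lemma inner_sumr n f (c : nat -> C) (g : nat -> C -> C) :
    square_integrable mu f -> (forall i, square_integrable mu (g i)) ->
  inner f (fun z => \sum_(i < n) c i * g i z) = \sum_(i < n) c i * inner f (g i).
Proof.
move=> sf sg; rewrite /inner.
rewrite (eq_circle_int mu (g := fun z => \sum_(i < n) c i * ((f z)^*%R * g i z))).
  rewrite circle_int_sum => [|i].
    apply: eq_bigr => i _; rewrite circle_intZ //.
    by apply: square_integrableM => //; exact: square_integrable_conj.
  apply: cintegrableZ.
  by apply: square_integrableM => //; exact: square_integrable_conj.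
by move=> z _; rewrite mulr_sumr; apply: eq_bigr => i _; rewrite mulrCA.
Qed.

Lemma inner_ge0 f : 0 <= inner f f.
Proof.
by apply: circle_int_ge0 => z _; rewrite mulrC -normCK exprn_ge0.
Qed.

Lemma inner_normsq f : inner f f = circle_int mu (fun z => `|f z| ^+ 2).
Proof. by apply: eq_circle_int => z _; rewrite mulrC -normCK. Qed.

End InnerProduct.

(** * Reversed polynomials on the circle *)

Section Circle.
Variable R : realType.
Local Notation C := R[i].
Implicit Types (z : C) (p : {poly C}).

Lemma circle_conj z : circle z -> z * (z^*)%R = 1.
Proof. by move=> z1; rewrite -normCK z1 expr1n. Qed.

Lemma circle_neq0 z : circle z -> z != 0.
Proof. by move=> z1; rewrite -normr_eq0 z1 oner_eq0. Qed.

Lemma revp_circle n p z : circle z -> (size p <= n.+1)%N ->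
  (revp n p).[z] = z ^+ n * (p.[z])^*%R.
Proof.
move=> z1 sp; rewrite horner_revp // ?circle_neq0 //.
suff -> : 1 / (z^*)%R = z by [].
by rewrite -(circle_conj z1) mulfK // conjC_eq0 circle_neq0.
Qed.

Lemma norm_revp_circle n p z : circle z -> (size p <= n.+1)%N ->
  `|(revp n p).[z]| = `|p.[z]|.
Proof.
by move=> z1 sp; rewrite revp_circle // normrM normrX z1 expr1n mul1r norm_conjC.
Qed.

Lemma coef_revp n p i :
  (revp n p)`_i = if (i <= n)%N then ((p`_(n - i))^*)%R else 0.
Proof. by rewrite coef_poly ltnS. Qed.

End Circle.

Section Szego.
Variable R : realType.
Local Notation C := R[i].
Variables (alpha : nat -> C) (mu : probability (borelC R) R).
Variable S : nat -> {poly C}.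
Hypothesis hmu : nontrivial_prob mu.
Hypothesis hS : monic_OPUC mu S.
Hypothesis hverb : forall n : nat, verblunsky alpha n = - ((S n).[0])^*%R.

Let sq (p : {poly C}) : square_integrable mu (fun z => p.[z]).
Proof. exact: square_integrable_horner. Qed.

Lemma size_OPUC n : size (S n) = n.+1.
Proof. by case: hS => /(_ n)[]. Qed.

Lemma lead_OPUC n : (S n)`_n = 1.
Proof.
by case: hS => /(_ n)[/monicP + sn] _; rewrite lead_coefE sn.
Qed.

(** Induction on the degree bound: subtracting the top coefficient times the monic [S m] lowers the
    degree, and [S m] itself is orthogonal to [S n]. *)
Lemma OPUC_orthogonal n (p : {poly C}) : (size p <= n)%N ->
  inner mu (fun z => p.[z]) (fun z => (S n).[z]) = 0.
Proof.
move=> sp; rewrite -inner_conj //.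
suff: forall m (q : {poly C}), (m <= n)%N -> (size q <= m)%N ->
    inner mu (fun z => (S n).[z]) (fun z => q.[z]) = 0.
  by move=> /(_ n p (leqnn _) sp) ->; rewrite conjC0.
elim=> [|m ih] q mn sq'.
  move: sq'; rewrite leqn0 size_poly_eq0 => /eqP ->.
  rewrite /inner (eq_circle_int mu (g := fun=> 0)).
    by rewrite circle_int_cst //; case: hmu.
  by move=> z _; rewrite horner0 mulr0.
have -> : (fun z => q.[z]) =
    (fun z => (q - q`_m *: S m).[z] + q`_m * (S m).[z]).
  by apply/funext => z; rewrite !hornerE subrK.
have sqm : square_integrable mu (fun z => q`_m * (S m).[z]).
  by under eq_fun do rewrite -hornerZ.
rewrite innerDr // innerZr // ih ?add0r ?(ltnW mn) //.
  case: hS => _ /(_ n m); rewrite -/(inner mu _ _) => -> //.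
    by rewrite mulr0.
  by rewrite gtn_eqF.
apply/leq_sizeP => j; rewrite leq_eqVlt coefB coefZ => /predU1P[<-|mj].
  by rewrite lead_OPUC mulr1 subrr.
rewrite (nth_default _ (leq_trans sq' mj)) [(S m)`_j]nth_default ?size_OPUC //.
by rewrite mulr0 subrr.
Qed.

Lemma OPUC_coef0 n : (S n.+1)`_0 = - (alpha n)^*%R.
Proof.
have := hverb n.+1; rewrite /= => ->.
by rewrite rmorphN /= conjCK opprK horner_coef0.
Qed.

(** The difference [P] of the two sides has degree at most [n], both leading terms being 1, and
    vanishes at 0 by the choice of [alpha n]. It is orthogonal to each term of its own definition,
    so its norm is zero and the infinite support gives [P = 0]. *)
Lemma szego_recurrence n :
  S n.+1 = 'X * S n - (alpha n)^*%R *: revp n (S n).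
Proof.
have [mu1 infs] := hmu.
apply/eqP; rewrite -subr_eq0; apply/eqP; set P := _ - _.
have sP : (size P <= n.+1)%N.
  apply/leq_sizeP => j nj; rewrite /P !coefB coefXM coefZ coef_revp.
  case: j nj => // j; rewrite ltnS => nj.
  rewrite ltnNge nj /= mulr0 subr0.
  move: nj; rewrite leq_eqVlt => /predU1P[<-|nj].
    by rewrite !lead_OPUC subrr.
  by rewrite !nth_default ?size_OPUC ?subrr.
have P0 : P`_0 = 0.
  rewrite /P !coefB coefXM coefZ coef_revp /= subn0 lead_OPUC OPUC_coef0.
  by rewrite conjC1 mulr1 sub0r opprK addNr.
have [q Pq] : exists q, P = 'X * q.
  exists (\poly_(i < n) P`_i.+1); apply/polyP => -[|j].
    by rewrite coefXM.
  rewrite coefXM coef_poly /=; case: ltnP => // nj.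
  by rewrite nth_default // (leq_trans sP).
have sq' : (size q <= n)%N.
  have [->|q0] := eqVneq q 0; first by rewrite size_poly0.
  by move: sP; rewrite Pq mulrC size_mulX.
have sXS : square_integrable mu (fun z => z * (S n).[z]).
  by have := sq ('X * S n); under eq_fun do rewrite !hornerE.
(* [P] is divisible by [z], hence orthogonal to each term of its definition. *)
have i1 := OPUC_orthogonal sP.
have i2 : inner mu (fun z => P.[z]) (fun z => z * (S n).[z]) = 0.
  rewrite -[RHS](OPUC_orthogonal sq'); apply: eq_circle_int => z z1.
  rewrite Pq hornerM hornerX rmorphM /= mulrACA.
  by rewrite [(z^*)%R * z]mulrC circle_conj ?mul1r.
(* On the circle reversal exchanges the factors: this product equals that of [S n] with the reversal
   of [P], whose degree is below [n] because [P] vanishes at 0. *)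
have i3 : inner mu (fun z => P.[z]) (fun z => (revp n (S n)).[z]) = 0.
  have sr : (size (revp n P) <= n)%N.
    apply/leq_sizeP => j; rewrite leq_eqVlt coef_revp => /predU1P[<-|nj].
      by rewrite leqnn subnn P0 conjC0.
    by rewrite leqNgt nj.
  rewrite -[RHS]conjC0 -(OPUC_orthogonal sr) inner_conj //.
  apply: eq_circle_int => z z1.
  rewrite !revp_circle // ?size_OPUC //.
  by ring.
apply: (infinite_supp_circle_int_eq0 mu1 infs).
rewrite -(inner_normsq mu (fun z => P.[z])).
have PE : (fun z => P.[z]) = (fun z => (S n.+1).[z] +
    (-1 * (z * (S n).[z]) + (alpha n)^*%R * (revp n (S n)).[z])).
  apply/funext => z; rewrite /P !(hornerD, hornerN, hornerM, hornerX, hornerZ).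
  ring.
have s1 : square_integrable mu (fun z => -1 * (z * (S n).[z])).
  by have := sq (- ('X * S n)); under eq_fun do rewrite !hornerE -mulN1r.
have s2 : square_integrable mu (fun z => (alpha n)^*%R * (revp n (S n)).[z]).
  by under eq_fun do rewrite -hornerZ.
have s3 : square_integrable mu (fun z =>
    -1 * (z * (S n).[z]) + (alpha n)^*%R * (revp n (S n)).[z]).
  by have := sq (- ('X * S n) + (alpha n)^*%R *: revp n (S n));
    under eq_fun do rewrite !hornerE -mulN1r.
by rewrite [X in inner mu _ X]PE !innerDr // !innerZr // i1 i2 i3 !mulr0 !addr0.
Qed.

Lemma szego_recurrence_revp n :
  revp n.+1 (S n.+1) = revp n (S n) - alpha n *: ('X * S n).
Proof.
apply/polyP => -[|j]; rewrite coefB coefZ coefXM !coef_revp /=.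
  by rewrite !subn0 !lead_OPUC mulr0 subr0.
rewrite ltnS subSS; case: (leqP j n) => jn; last first.
  by rewrite ltnNge (ltnW jn) /= nth_default ?size_OPUC // mulr0 subr0.
rewrite szego_recurrence coefB coefXM coefZ coef_revp leq_subr subKn //.
rewrite rmorphB rmorphM /= !conjCK subn_eq0 -subnS.
by case: ltnP => _ //; rewrite conjC0.
Qed.

Lemma OPUC0 : S 0 = 1.
Proof.
have := size_OPUC 0; move/eqP/size_poly1P => [c c0 e].
by have := lead_OPUC 0; rewrite e coefC /= => ->.
Qed.

Lemma revp_OPUC0 : revp 0 (S 0) = 1.
Proof.
apply/polyP => i; rewrite coef_revp OPUC0 !coef1.
by case: i => [|i] //=; rewrite conjC1.
Qed.

(** The squared norm of [S n] in the space of square-integrable functions; see [OPUC_normE]. *)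
Definition OPUC_norm (n : nat) : C := \prod_(k < n) (1 - `|alpha k| ^+ 2).

(** Pythagoras applied to [z S_n = S_{n+1} + conj(alpha_n) T] with [T] the reversal of [S n]: the
    two terms are orthogonal by degree, while [z S_n] and [T] both have the norm of [S n]. *)
Lemma OPUC_normE n :
  inner mu (fun z => (S n).[z]) (fun z => (S n).[z]) = OPUC_norm n.
Proof.
have [mu1 _] := hmu.
elim: n => [|n ih].
  rewrite /OPUC_norm big_ord0 OPUC0 /inner.
  under eq_fun do rewrite hornerC conjC1 mulr1.
  exact: circle_int_cst.
rewrite /OPUC_norm big_ord_recr /= -/(OPUC_norm n).
pose T z := (revp n (S n)).[z].
have iT : inner mu T T = OPUC_norm n.
  rewrite -ih !inner_normsq; apply: eq_circle_int => z z1.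
  by rewrite norm_revp_circle ?size_OPUC.
have i0 : inner mu T (fun z => (S n.+1).[z]) = 0.
  by apply: OPUC_orthogonal; exact: size_poly.
have sT : square_integrable mu T by exact: sq.
have sa : square_integrable mu (fun z => (alpha n)^*%R * T z).
  by rewrite /T; under eq_fun do rewrite -hornerZ.
have e z : z * (S n).[z] = (S n.+1).[z] + (alpha n)^*%R * T z.
  by rewrite szego_recurrence !hornerE subrK.
pose F z := (S n.+1).[z] + (alpha n)^*%R * T z.
have sF : square_integrable mu F.
  by have := sq ('X * S n); under eq_fun do rewrite !hornerE e.
have : OPUC_norm n = inner mu F F.
  rewrite -ih !inner_normsq; apply: eq_circle_int => z z1.
  by rewrite /F -e normrM z1 mul1r.
have FS : inner mu F (fun z => (S n.+1).[z]) =
    inner mu (fun z => (S n.+1).[z]) (fun z => (S n.+1).[z]).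
  rewrite -inner_conj // /F innerDr // innerZr // -[inner mu _ T]inner_conj //.
  by rewrite i0 conjC0 mulr0 addr0 inner_conj.
have FT : inner mu F T = alpha n * OPUC_norm n.
  rewrite -inner_conj // /F innerDr // innerZr // i0 add0r iT rmorphM /= conjCK.
  by rewrite -iT inner_conj.
rewrite {2}/F innerDr // innerZr // FS FT normCK => h.
by apply/eqP; rewrite mulrBr mulr1 eq_sym subr_eq {1}h; apply/eqP; ring.
Qed.

Lemma OPUC_norm_revp n : circle_int mu (fun z => `|(revp n (S n)).[z]| ^+ 2) =
  OPUC_norm n.
Proof.
rewrite -OPUC_normE inner_normsq; apply: eq_circle_int => z z1.
by rewrite norm_revp_circle ?size_OPUC.
Qed.

End Szego.

(** * Three-term recurrence *)

Section Rho.
Variable R : realType.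
Local Notation C := R[i].
Variables (alpha : nat -> C) (rho0 : C).
Hypothesis halpha : forall n, `|alpha n| < 1.
Hypothesis rho0_1 : `|rho0| = 1.
Hypothesis rho0_neq1 : rho0 != 1.

Local Notation rho := (rho alpha rho0).
Local Notation w n := (rho n * verblunsky alpha n).
Local Notation e n := ((1 + complex.Re (w n))%:C).

Lemma one_sub_neq0 (z : C) : `|z| < 1 -> 1 - z != 0.
Proof.
by apply: contraTneq => /eqP; rewrite subr_eq0 => /eqP <-; rewrite normr1 ltxx.
Qed.

Lemma one_sub_normsq_gt0 n : 0 < 1 - `|alpha n| ^+ 2.
Proof. by rewrite subr_gt0 expr_lt1. Qed.

(** When [rho n] is unimodular, the denominator of the next term is [rho n] times the conjugate of
    the numerator, so the quotient has modulus 1. *)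
Lemma norm_rho n : `|rho n| = 1.
Proof.
elim: n => //= n ih.
have d0 : 1 - rho n * alpha n != 0 by rewrite one_sub_neq0 // normrM ih mul1r.
have dE : 1 - rho n * alpha n = rho n * ((rho n - (alpha n)^*)^*)%R.
  by rewrite rmorphB /= conjCK mulrBr -normCK ih expr1n.
move: d0; rewrite -normr_eq0 normrM normfV dE normrM ih mul1r norm_conjC.
exact: mulfV.
Qed.

Lemma rho_neq0 n : rho n != 0.
Proof. by rewrite -normr_eq0 norm_rho oner_eq0. Qed.

Lemma rho_conj n : (rho n)^*%R = (rho n)^-1.
Proof.
by apply: (mulfI (rho_neq0 n)); rewrite -normCK norm_rho expr1n mulfV ?rho_neq0.
Qed.

Lemma one_sub_rho_neq0 n : 1 - rho n * alpha n != 0.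
Proof. by rewrite one_sub_neq0 // normrM norm_rho mul1r. Qed.

(** For [n = 0] this is the condition [rho0 != 1], since [w_0 = - rho0]; for larger [n] it follows
    from [|w_n| < 1]. *)
Lemma one_plus_w_neq0 n : 1 + w n != 0.
Proof.
case: n => [|n]; first by rewrite mulrN1 subr_eq0 eq_sym.
by rewrite -[rho _ * _]opprK one_sub_neq0 // normrN normrM norm_rho mul1r /=.
Qed.

Lemma norm_w_le1 n : `|w n| <= 1.
Proof.
rewrite normrM norm_rho mul1r; case: n => [|n] /=; last exact: ltW.
by rewrite normrN1.
Qed.

Lemma one_plus_wE n :
  1 + w n.+1 = (1 - `|alpha n| ^+ 2) / (1 - rho n * alpha n).
Proof.
by rewrite /= normCK; have := one_sub_rho_neq0 n; move: (rho n) => r h; field.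
Qed.

Lemma complex_ReE (z : C) : 2 * (complex.Re z)%:C = z + (z^*)%R.
Proof. by case: z => a b; rewrite mulrDl !mul1r; simpc. Qed.

Lemma eE n : 2 * e n = 2 + w n + (w n)^*%R.
Proof. by rewrite rmorphD mulrDr complex_ReE mulr1 addrA. Qed.

Lemma e_gt0 n : 0 < 1 + complex.Re (w n).
Proof.
have : 0 < `|1 + w n| ^+ 2 by rewrite exprn_gt0 // normr_gt0 one_plus_w_neq0.
have le1 : 0 <= 1 - `|w n| ^+ 2 by rewrite subr_ge0 expr_le1 // norm_w_le1.
move=> h; have := ltr_wpDr le1 h.
have -> : `|1 + w n| ^+ 2 + (1 - `|w n| ^+ 2) = 2 * e n.
  by rewrite eE !normCK rmorphD rmorph1; ring.
by rewrite pmulr_rgt0 // ltcR.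
Qed.

Lemma e_neq0 n : e n != 0.
Proof. by rewrite lt0r_neq0 // ltcR e_gt0. Qed.

Lemma mparE n : (mpar alpha rho0 n)%:C =
  (1 - w n * (w n)^*%R) / (2 * e n).
Proof.
rewrite /mpar -normCK; rewrite rmorphM rmorphM !fmorphV /= rmorphB rmorphXn /=.
by rewrite invfM -[(Normc.normc _)%:C]/(`|w n|) rmorph_nat mulrCA.
Qed.

(** The numerator is [|1 + w_n|^2], which accounts for [m_n < 1] and puts [d1] in the form needed
    for the recurrence. *)
Lemma one_sub_mparE n : (1 - mpar alpha rho0 n)%:C =
  (1 + w n) * (1 + (w n)^*%R) / (2 * e n).
Proof.
rewrite rmorphB /= mparE.
have e0 : 2 * e n != 0 by rewrite mulf_neq0 ?e_neq0 ?pnatr_eq0.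
apply: (mulIf e0); rewrite mulrBl !mulfVK // {1}eE; ring.
Qed.

Lemma d1E n : (4 * d1 alpha rho0 n.+1)%:C =
  (1 + w n) * (1 + (w n)^*%R) * (1 - w n.+1 * (w n.+1)^*%R) / (e n * e n.+1).
Proof.
have realcM (x y : R) : (x * y)%:C = x%:C * y%:C := rmorphM (real_complex R) x y.
rewrite /d1 -[n.+1.-1]/n (realcM 4) (realcM (1 - _)) one_sub_mparE mparE.
rewrite -[4%:C]/(real_complex R 4) rmorph_nat.
move: (e n) (e n.+1) (e_neq0 n) (e_neq0 n.+1) => x y hx hy; field.
by rewrite hx hy.
Qed.

Lemma mpar0 : mpar alpha rho0 0 = 0.
Proof.
apply: complexI; rewrite mparE /= mulrN1 -normCK normrN rho0_1 expr1n subrr.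
by rewrite mul0r.
Qed.

Lemma mpar_lt1 n : mpar alpha rho0 n < 1.
Proof.
rewrite -subr_gt0 -ltcR one_sub_mparE.
have -> : 1 + (w n)^*%R = (1 + w n)^*%R by rewrite rmorphD rmorph1.
rewrite -normCK divr_gt0 // ?exprn_gt0 ?normr_gt0 ?one_plus_w_neq0 //.
by rewrite mulr_gt0 // ltcR e_gt0.
Qed.

Lemma mpar_gt0 n : 0 < mpar alpha rho0 n.+1.
Proof.
rewrite -ltcR mparE -normCK divr_gt0 //; last by rewrite mulr_gt0 // ltcR e_gt0.
by rewrite normrM norm_rho mul1r one_sub_normsq_gt0.
Qed.

Lemma mpar_minimal : minimal_parameter_seq (d1 alpha rho0) (mpar alpha rho0).
Proof.
split; last exact: mpar0.
split; first by rewrite mpar0 lexx ltr01.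
  by case=> // n _; rewrite mpar_gt0 mpar_lt1.
by case.
Qed.

(** The left-hand side is the ratio in Wall's criterion; the right-hand side is the growth factor of
    [|v_n|^2 / ||S_n||^2] for a solution of the recurrence at 1. *)
Lemma mpar_ratioE n :
  (mpar alpha rho0 n.+1 / (1 - mpar alpha rho0 n.+1))%:C =
  `|1 - rho n * alpha n| ^+ 2 / (1 - `|alpha n| ^+ 2).
Proof.
rewrite [LHS](rmorphM (real_complex R)) [X in _ * X]fmorphV.
rewrite [X in _ * X^-1]one_sub_mparE [X in X * _]mparE.
have e0 : 2 * e n.+1 != 0 by rewrite mulf_neq0 ?e_neq0 ?pnatr_eq0.
rewrite invf_div mulrA (mulfVK e0).
have -> : 1 + (w n.+1)^*%R = (1 + w n.+1)^*%R by rewrite rmorphD rmorph1.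
rewrite -!normCK normrM norm_rho mul1r one_plus_wE normrM normfV /=.
rewrite (ger0_norm (ltW (one_sub_normsq_gt0 n))).
have := one_sub_rho_neq0 n; rewrite -normr_eq0.
have := lt0r_neq0 (one_sub_normsq_gt0 n).
by move: `|_| (1 - _) => x y hx hy; field; rewrite hx hy.
Qed.

(** The formula for [c_{n+1}] is used at [n = 0] too, where it gives the stated [c_1] by [ttrr_c1E];
    the value at index 0 is a dummy. *)
Definition ttrr_c (n : nat) : R :=
  if n is k.+1 then - complex.Im (w k) / (1 + complex.Re (w k)) else 0.

Lemma ttrr_cE n : 1 +i* ttrr_c n.+1 = (1 + (w n)^*%R) / e n.
Proof.
have e0 := e_gt0 n; have {}e0 := lt0r_neq0 e0.
apply: (canRL (mulfK (e_neq0 n))).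
move: e0; rewrite /=; case: (rho n * _) => a b /= a0; simpc; congr (_ +i* _).
by rewrite mulfVK.
Qed.

Lemma ttrr_c_conjE n : 1 -i* ttrr_c n.+1 = (1 + w n) / e n.
Proof.
rewrite -[LHS]/((1 +i* ttrr_c n.+1)^*)%R ttrr_cE rmorphM fmorphV /=.
rewrite rmorphD /= rmorph1 conjCK; congr (_ / _).
by rewrite -[LHS]/(_ -i* _); simpc.
Qed.

Lemma ttrr_c1E : (ttrr_c 1)%:C = 'i%C * ((rho0 + 1) / (rho0 - 1)).
Proof.
have r0 := rho_neq0 0; have r1 : rho0 - 1 != 0 by rewrite subr_eq0.
have i0 : 'i%C != 0 :> C by rewrite eq_complex /= oner_eq0 andbF.
have eE0 : e 0 = (1 + w 0 + (1 + (w 0)^*%R)) / 2.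
  apply: (canRL (mulfK _)); first by rewrite pnatr_eq0.
  by rewrite mulrC eE; ring.
apply: (mulfI i0); rewrite [RHS]mulrA -['i%C * 'i%C]expr2 sqr_i mulN1r.
have -> : 'i%C * (ttrr_c 1)%:C = 1 +i* ttrr_c 1 - 1.
  move: (ttrr_c 1) => c; apply/eqP; rewrite eq_complex /=.
  by apply/andP; split; apply/eqP; ring.
have wc : (w 0)^*%R = - rho0^-1.
  have /= rc := rho_conj 0.
  by rewrite rmorphM /= rmorphN rmorph1 mulrN1 rc.
rewrite ttrr_cE eE0 wc /= mulrN1; field; rewrite r1 r0 /=.
have -> : (1 - rho0) * rho0 + (rho0 - 1) = - (rho0 - 1) ^+ 2 by ring.
by rewrite oppr_eq0 expf_neq0.
Qed.

End Rho.

(* The three-term recurrence, coefficient by coefficient: [s], [s'], [t], [t']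
   stand for coefficients of [z S_n], [z^2 S_n], [S_n^*], [z S_n^*], and
   [x2], [x], [x'], [y] for those of [R_{n+2}], [R_{n+1}], [z R_{n+1}],
   [z R_n]. *)
Lemma ttrr_scalar (F : fieldType)
    (r a b wk wkb wn wb ek en Lam s s' t t' x2 x x' y : F) :
  r != 0 -> 1 - r * a != 0 -> 1 - r^-1 * b != 0 ->
  wn = (r - b) / (1 - r * a) * a ->
  wb = (r^-1 - a) / (1 - r^-1 * b) * b ->
  1 + wk != 0 -> 1 + wkb != 0 -> 1 + wb != 0 ->
  ek != 0 -> en != 0 -> Lam != 0 ->
  Lam * (ek / (1 + wkb)) * x' = s' - r * t' ->
  Lam * (ek / (1 + wkb)) * (en / (1 + wb)) * x2 =
    s' - b * t' - (r - b) / (1 - r * a) * (t - a * s) ->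
  (1 + wk) * (Lam * y) = s - r * t' ->
  Lam * (ek / (1 + wkb)) * x = s - r * t ->
  x2 = (1 + wb) / en * x' + (1 + wn) / en * x
       - (1 + wk) * (1 + wkb) * (1 - wn * wb) / (ek * en) * y.
Proof.
move=> r0 ra0 rb0 -> wbE wk0 wkb0 wb0 ek0 en0 L0 Ex' Ex2 Ey Ex.
have c0 : Lam * (ek / (1 + wkb)) != 0 by rewrite !mulf_neq0 ?invr_eq0.
have d0 : Lam * (ek / (1 + wkb)) * (en / (1 + wb)) != 0.
  by rewrite mulf_neq0 ?invr_eq0 // mulf_neq0 ?invr_eq0.
rewrite -[x2](mulKf d0) Ex2 -[x](mulKf c0) Ex -[x'](mulKf c0) Ex'.
rewrite -[y](mulKf L0) -[Lam * y](mulKf wk0) Ey.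
move: wb0; rewrite {}wbE => wb0.
have rb1 : r - b != 0.
  by apply: contra rb0; rewrite !subr_eq0 => /eqP <-; rewrite mulVf.
(* Since [1 + wb = (1 - a b) / (1 - b / r)], clearing denominators brings up [1 - a b]. *)
have ab0 : 1 - a * b != 0.
  have -> : 1 - a * b = (1 + (r^-1 - a) / (1 - r^-1 * b) * b) * (1 - r^-1 * b).
    by field; rewrite r0.
  by rewrite mulf_neq0.
field.
rewrite ?r0 ?rb1 ?ab0 ?ra0 ?ek0 ?en0 ?wk0 ?wkb0 ?L0 /=.
have -> : r - b + (1 + - a * r) * b = r * (1 - a * b) by ring.
by rewrite mulf_neq0.
Qed.

(** * The recurrence for the para-orthogonal polynomials *)

Section ThreeTermRecurrence.
Variable R : realType.
Local Notation C := R[i].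
Variables (alpha : nat -> C) (mu : probability (borelC R) R).
Variable S : nat -> {poly C}.
Hypothesis halpha : forall n, `|alpha n| < 1.
Hypothesis hmu : nontrivial_prob mu.
Hypothesis hS : monic_OPUC mu S.
Hypothesis hverb : forall n : nat, verblunsky alpha n = - ((S n).[0])^*%R.
Variables (rho0 : C) (Rn : nat -> {poly C}).
Hypothesis rho0_1 : `|rho0| = 1.
Hypothesis rho0_neq1 : rho0 != 1.
Local Notation rho := (rho alpha rho0).
Local Notation w n := (rho n * verblunsky alpha n).
Local Notation e n := ((1 + complex.Re (w n))%:C).
Local Notation L n := (\prod_(k < n)
  (e k / (1 + (rho k)^*%R * (verblunsky alpha k)^*%R))).
Hypothesis Rn0 : Rn 0 = 1.
Hypothesis hR : forall n : nat, (1 <= n)%N ->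
  L n *: Rn n = 'X * S n.-1 - rho n.-1 *: revp n.-1 (S n.-1).

Lemma one_plus_wconj_neq0 n :
  1 + (rho n)^*%R * (verblunsky alpha n)^*%R != 0.
Proof.
by rewrite -rmorphM -[1]conjC1 -rmorphD conjC_eq0 one_plus_w_neq0.
Qed.

Lemma POPUC_factor_neq0 n : L n != 0.
Proof.
apply/prodf_neq0 => k _.
by rewrite mulf_neq0 ?invr_eq0 ?one_plus_wconj_neq0 ?e_neq0.
Qed.

(* The same polynomial in terms of the degree [n] rather than the degree
   [n - 1] orthogonal polynomials; for [n = 0] this covers [R_0 = 1]. *)
Lemma POPUC_eq n :
  (1 + w n) *: (L n *: Rn n) = S n - rho n *: revp n (S n).
Proof.
case: n => [|n].
  rewrite big_ord0 Rn0 scale1r (revp_OPUC0 hS) (OPUC0 hS) /= mulrN1.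
  by rewrite scalerBl scale1r.
rewrite hR // -[n.+1.-1]/n (szego_recurrence_revp hmu hS hverb).
rewrite (szego_recurrence hmu hS hverb).
apply/polyP => i; rewrite !(coefB, coefZ) /=.
have := one_sub_rho_neq0 halpha rho0_1 n.
by move: (rho n) (_`_i) (_`_i) => r x y h; field.
Qed.

Lemma para_orthogonal_POPUC n : (1 <= n)%N -> para_orthogonal S n (Rn n).
Proof.
move=> n0; exists (L n)^-1, (rho n.-1); split.
- by rewrite invr_eq0 POPUC_factor_neq0.
- by rewrite norm_rho.
- by rewrite -hR // scalerA mulVf ?scale1r // POPUC_factor_neq0.
Qed.

Lemma ttrr1 : Rn 1 =
  (1 +i* ttrr_c alpha rho0 1) *: 'X + (1 -i* ttrr_c alpha rho0 1)%:P.
Proof.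
apply: (scalerI (POPUC_factor_neq0 1)).
rewrite hR // big_ord_recl big_ord0 mulr1 ttrr_cE // ttrr_c_conjE //.
rewrite (revp_OPUC0 hS) (OPUC0 hS) mulr1.
have := e_neq0 halpha rho0_1 rho0_neq1 0; have := one_plus_wconj_neq0 0.
have := rho_conj halpha rho0_1 0; rewrite /= !mulrN1 !rmorphN /= rmorph1 mulrN1 => ->.
move: (rho_neq0 halpha rho0_1 0) => /= r0.
move: (_%:C) => x hx x0.
apply/polyP => i; rewrite !(coefB, coefZ, coefD, coefC, coef1, coefX).
move: (i == 1)%N%:R => a; case: (i == 0)%N => /=; field; 
  by rewrite ?x0 ?r0 //= subr_eq0.
Qed.

Lemma ttrr n : (1 <= n)%N ->
  Rn n.+1 = ((1 +i* ttrr_c alpha rho0 n.+1) *: 'X +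
             (1 -i* ttrr_c alpha rho0 n.+1)%:P) * Rn n
            - (4 * d1 alpha rho0 n)%:C *: ('X * Rn n.-1).
Proof.
case: n => // n _; rewrite -[n.+1.-1]/n ttrr_cE // ttrr_c_conjE // d1E //.
(* After the shift of [n] the recurrence links the degrees [n], [n+1] and [n+2]. [POPUC_eq] for the
   lowest degree, the definition for the middle one and the Szego recurrence for the highest express
   all three through [S n] and its reversal. *)
have E0 := congr1 (fun p => 'X * p) (POPUC_eq n).
have E1 : L n.+1 *: Rn n.+1 = 'X * S n - rho n *: revp n (S n) by rewrite hR.
have E1X := congr1 (fun p => 'X * p) E1.
have E2 : L n.+2 *: Rn n.+2 = 'X * S n.+1 - rho n.+1 *: revp n.+1 (S n.+1).
  by rewrite hR.
have LS m : L m.+1 = L m * (e m / (1 + (rho m)^*%R * (verblunsky alpha m)^*%R)).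
  exact: big_ord_recr.
have L0 := POPUC_factor_neq0 n.
rewrite !LS -!scalerAr mulrBr -scalerAr in E0 E1 E1X E2.
rewrite mulrBr -scalerAr in E1X.
rewrite (szego_recurrence_revp hmu hS hverb) in E2.
rewrite (szego_recurrence hmu hS hverb) mulrBr -scalerAr in E2.
set Lam := \prod_(k < n) _ in E0 E1 E1X E2 L0.
apply/polyP => i.
rewrite mulrDl -scalerAl mul_polyC !(coefB, coefD, coefZ).
have wS : w n.+1 = (rho n - (alpha n)^*%R) / (1 - rho n * alpha n) * alpha n.
  by [].
have wSb : (w n.+1)^*%R =
    ((rho n)^-1 - alpha n) / (1 - (rho n)^-1 * (alpha n)^*%R) * (alpha n)^*%R.
  rewrite wS !rmorphM /= fmorphV !rmorphB rmorphM rmorph1 /= conjCK.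
  by rewrite (rho_conj halpha rho0_1).
have wn0 := one_plus_w_neq0 halpha rho0_1 rho0_neq1 n.
have wSb0 := one_plus_wconj_neq0 n.+1.
move: (congr1 (fun p : {poly C} => p`_i) E0) (congr1 (fun p : {poly C} => p`_i) E1).
move: (congr1 (fun p : {poly C} => p`_i) E1X) (congr1 (fun p : {poly C} => p`_i) E2).
have wc m : (rho m)^*%R * (verblunsky alpha m)^*%R = (w m)^*%R.
  by rewrite rmorphM.
cbv beta; rewrite !(coefB, coefZ) !wc.
apply: (ttrr_scalar (rho_neq0 halpha rho0_1 n) _ _ wS wSb) => //.
- exact: one_sub_rho_neq0.
- rewrite -(rho_conj halpha rho0_1) -rmorphM -[1]conjC1 -rmorphB conjC_eq0.
  exact: one_sub_rho_neq0.
- by rewrite rmorphM; exact: one_plus_wconj_neq0.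
- by rewrite rmorphM; exact: one_plus_wconj_neq0.
- exact: e_neq0.
- exact: e_neq0.
Qed.

End ThreeTermRecurrence.

(** * Wall's criterion *)

Section Wall.
Variable R : realType.
Variables (a m : nat -> R).
Hypothesis am : minimal_parameter_seq a m.

Local Notation P n := (\prod_(k < n) (m k.+1 / (1 - m k.+1))).

Let m0 : m 0 = 0. Proof. by case: am. Qed.
Let aE n : a n.+1 = (1 - m n) * m n.+1.
Proof. by case: am => -[_ _ ->]. Qed.
Let m_gt0 n : 0 < m n.+1.
Proof. by case: am => -[_ /(_ n.+1 isT) /andP[]]. Qed.
Let m_lt1 n : m n < 1.
Proof.
case: n => [|n]; first by rewrite m0 ltr01.
by case: am => -[_ /(_ n.+1 isT) /andP[]].
Qed.
Let om_gt0 n : 0 < 1 - m n. Proof. by rewrite subr_gt0. Qed.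
Let r_gt0 n : 0 < m n.+1 / (1 - m n.+1). Proof. by rewrite divr_gt0. Qed.
Let P_gt0 n : 0 < P n. Proof. by apply: prodr_gt0. Qed.

Lemma minimal_parameter_seq_unique m' : minimal_parameter_seq a m' -> m' =1 m.
Proof.
move=> [[_ _ h] m'0]; elim=> [|n ih]; first by rewrite m0.
have := h n.+1 isT; rewrite aE /= ih => /mulfI -> //.
by rewrite lt0r_neq0.
Qed.

(** The minimal sequence is unique and starts at 0, so it is also maximal exactly when no parameter
    sequence starts above 0. *)
Lemma SPPCS_iff : SPPCS a <-> forall g, parameter_seq a g -> g 0 = 0.
Proof.
split=> [[_ [m' mm' [_ maxm']]] g pg|h].
  apply/eqP; rewrite eq_le; case: (pg) => /andP[-> _] _ _; rewrite andbT.
  by rewrite -m0 -(minimal_parameter_seq_unique mm'); exact: maxm'.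
split; first by exists m; case: am.
exists m => //; split; first by case: am.
by move=> g /h ->; rewrite m0.
Qed.

(* With [x_n = (1 - m_n) / (g_n - m_n)], the relation
   [(1 - g_n) g_{n+1} = (1 - m_n) m_{n+1}] becomes [x_n = 1 + r_{n+1} x_{n+1}],
   where [r_n = m_n / (1 - m_n)]. *)
Lemma parameter_seq_sum_le g : parameter_seq a g -> 0 < g 0 ->
  forall n, \sum_(k < n) P k <= (g 0)^-1.
Proof.
move=> [/andP[g0 g01] gb ga] g0p n.
have g_lt1 k : g k < 1 by case: k => // k; case/andP: (gb k.+1 isT).
pose x k := (1 - m k) / (g k - m k).
have gm k : 0 < g k - m k.
  elim: k => [|k ih]; first by rewrite m0 subr0.
  have := ga k.+1 isT; rewrite aE /= => h.
  have : (1 - g k) * (g k.+1 - m k.+1) = m k.+1 * (g k - m k).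
    by rewrite mulrBr -h; ring.
  rewrite -(pmulr_rgt0 _ (_ : 0 < 1 - g k)) ?subr_gt0 // => ->.
  by rewrite mulr_gt0.
have xS k : x k = 1 + m k.+1 / (1 - m k.+1) * x k.+1.
  have := ga k.+1 isT; rewrite aE /= => h.
  have h0 := lt0r_neq0 (gm k); have h1 := lt0r_neq0 (gm k.+1).
  have h2 := lt0r_neq0 (om_gt0 k.+1).
  have -> : 1 + m k.+1 / (1 - m k.+1) * x k.+1 = g k.+1 / (g k.+1 - m k.+1).
    by rewrite /x; field; rewrite h1 h2.
  by apply/eqP; rewrite /x eqr_div // mulrBr h; apply/eqP; ring.
(* Unrolling [xS]: here [x 0 = 1 / g 0] because [m 0 = 0], and the remainder is positive. *)
suff e k : x 0 = \sum_(j < k) P j + P k * x k.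
  have := e n; rewrite {1}/x m0 !subr0 div1r => ->.
  by rewrite lerDl mulr_ge0 ?ltW // divr_gt0.
elim: k => [|k ih]; first by rewrite !big_ord0 add0r mul1r.
by rewrite ih xS !big_ord_recr /=; ring.
Qed.

(** Conversely, [x_n = (B + 1 - T_n) / P_n] solves the recursion [x_n = 1 + r_{n+1} x_{n+1}], and
    inverting the substitution yields [g]. The extra 1 in the numerator makes [x_n > 1], hence
    [g_n < 1]. *)
Lemma bounded_sum_parameter_seq (B : R) :
  (forall n, \sum_(k < n) P k <= B) -> exists2 g, parameter_seq a g & 0 < g 0.
Proof.
move=> hB.
pose T n := \sum_(k < n) P k.
pose x n := (B + 1 - T n) / P n.
have TS n : T n.+1 = T n + P n by rewrite /T big_ord_recr.
have PS n : P n.+1 = P n * (m n.+1 / (1 - m n.+1)) by rewrite big_ord_recr.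
have x_gt1 n : 1 < x n.
  rewrite /x ltr_pdivlMr // mul1r ltrBrDl -TS.
  by rewrite (le_lt_trans (hB _)) // ltrDl.
have x_gt0 n : 0 < x n by rewrite (lt_trans ltr01).
have xS n : x n = 1 + m n.+1 / (1 - m n.+1) * x n.+1.
  rewrite /x PS TS.
  have h1 := lt0r_neq0 (P_gt0 n); have h2 := lt0r_neq0 (m_gt0 n).
  have h3 := lt0r_neq0 (om_gt0 n.+1).
  move: (T n) (P n) h1 (m n.+1) h2 h3 => t p h1 u h2 h3; field.
  by rewrite h1 h2 h3.
pose g n := m n + (1 - m n) / x n.
have g_lt1 n : g n < 1.
  by rewrite /g -ltrBrDl ltr_pdivrMr // ltr_pMr.
have g_ge n : 0 < g n - m n by rewrite /g addrAC subrr add0r divr_gt0.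
exists g; last by have := g_ge 0; rewrite m0 subr0.
split.
- by rewrite g_lt1 andbT ltW //; have := g_ge 0; rewrite m0 subr0.
- case=> // n _; rewrite g_lt1 andbT.
  by rewrite (lt_trans (m_gt0 n)) // -subr_gt0.
case=> // n _; rewrite aE /g /= (xS n).
have h1 := lt0r_neq0 (x_gt0 n.+1); have := lt0r_neq0 (x_gt0 n).
have h3 := lt0r_neq0 (om_gt0 n.+1).
rewrite xS; move: (x n.+1) h1 (m n.+1) h3 (m n) => y hy u hu v h; field.
have -> : 1 - u + u * y = (1 - u) * (1 + u / (1 - u) * y) by field.
by rewrite hy hu mulf_neq0.
Qed.

(** Wall's criterion; as the terms are positive, convergence is expressed by bounded partial
    sums. *)
Lemma not_SPPCS_iff : ~ SPPCS a <-> exists B, forall n, \sum_(k < n) P k <= B.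
Proof.
split=> [h|[B /bounded_sum_parameter_seq[g pg g0]] /SPPCS_iff h].
  apply: contrapT => nB; apply: h; apply/SPPCS_iff => g pg.
  apply/eqP; apply: contrapT => /negP g0; apply: nB.
  exists (g 0)^-1; apply: parameter_seq_sum_le => //.
  by rewrite lt_def g0; case: pg => /andP[].
by move: g0; rewrite (h _ pg) ltxx.
Qed.

End Wall.

(** * Square-summable solutions at 1 *)

Section Solutions.
Variable R : realType.
Local Notation C := R[i].
Variables (alpha : nat -> C) (u v : nat -> C).
Hypothesis halpha : forall n, `|alpha n| < 1.
Hypothesis uS : forall n, u n.+1 = u n - (alpha n)^*%R * v n.
Hypothesis vS : forall n, v n.+1 = v n - alpha n * u n.
Hypothesis uv0 : `|u 0| = `|v 0|.
Hypothesis v0_neq0 : v 0 != 0.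
Local Notation rho := (rho alpha (u 0 / v 0)).

Hypothesis uv_neq1 : u 0 / v 0 != 1.
Let rho0_1 : `|u 0 / v 0| = 1.
Proof. by rewrite normrM normfV uv0 mulfV // normr_eq0. Qed.

Lemma solution_step n : v n != 0 -> u n = rho n * v n ->
  v n.+1 = v n * (1 - rho n * alpha n).
Proof. by move=> vn un; rewrite vS un; ring. Qed.

(** The quotient [u_n / v_n] obeys the recursion that defines [rho]; nonvanishing of [v] must be
    carried along in the induction. *)
Lemma solution_rho n : v n != 0 /\ u n = rho n * v n.
Proof.
elim: n => [|n [vn un]]; first by rewrite /= mulfVK.
have r0 := one_sub_rho_neq0 halpha rho0_1 n.
have vE := solution_step vn un; split; first by rewrite vE mulf_neq0.
rewrite uS vE un /=; move: (rho n) r0 => r r0; field; exact: r0.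
Qed.

Lemma norm_solution n : `|u n| = `|v n|.
Proof. by case: (solution_rho n) => _ ->; rewrite normrM norm_rho ?mul1r. Qed.

(** Each step multiplies both sides by the same factor, by [solution_step] and [mpar_ratioE]. This
    ties Wall's sum to the square sum of a normalized solution. *)
Lemma normsq_solution n : `|v n| ^+ 2 / OPUC_norm alpha n = `|v 0| ^+ 2 *
  (\prod_(k < n) (mpar alpha (u 0 / v 0) k.+1 /
                  (1 - mpar alpha (u 0 / v 0) k.+1)))%:C.
Proof.
rewrite /OPUC_norm; elim: n => [|n ih]; first by rewrite !big_ord0 divr1 mulr1.
have [vn un] := solution_rho n.
have rE := mpar_ratioE halpha rho0_1 uv_neq1 n.
rewrite !(big_ord_recr n) /= [in RHS]rmorphM /= mulrA -ih rE.
rewrite (solution_step vn un) normrM exprMn invfM.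
by rewrite mulrACA.
Qed.

End Solutions.

(** * Expansions in the orthogonal polynomials and Bessel's inequality *)

Section Bessel.
Variable R : realType.
Local Notation C := R[i].
Variables (alpha : nat -> C) (mu : probability (borelC R) R).
Variable S : nat -> {poly C}.
Hypothesis halpha : forall n, `|alpha n| < 1.
Hypothesis hmu : nontrivial_prob mu.
Hypothesis hS : monic_OPUC mu S.
Hypothesis hverb : forall n : nat, verblunsky alpha n = - ((S n).[0])^*%R.
Local Notation kappa := (OPUC_norm alpha).
Let phi n (z : C) := (S n).[z].

Let sphi n : square_integrable mu (phi n).
Proof. exact: square_integrable_horner. Qed.

Lemma OPUC_norm_gt0 n : 0 < kappa n.
Proof. by apply: prodr_gt0 => k _; exact: one_sub_normsq_gt0. Qed.

Lemma OPUC_norm_conj n : (kappa n)^*%R = kappa n.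
Proof. by apply: conj_Creal; apply: gtr0_real; exact: OPUC_norm_gt0. Qed.

Let inner_phi m n : inner mu (phi m) (phi n) = (m == n)%:R * kappa n.
Proof.
case: eqVneq => [->|mn]; first by rewrite mul1r; exact: (OPUC_normE hmu hS hverb).
by rewrite mul0r; case: hS => _; exact.
Qed.

Definition OPUC_comb n (c : nat -> C) := \sum_(i < n) c i *: S i.

Lemma OPUC_combE n c (z : C) :
  (OPUC_comb n c).[z] = \sum_(i < n) c i * (S i).[z].
Proof. by rewrite horner_sum; apply: eq_bigr => i _; rewrite hornerZ. Qed.

Lemma inner_OPUC_comb n c k : (k < n)%N ->
  inner mu (phi k) (fun z => (OPUC_comb n c).[z]) = c k * kappa k.
Proof.
move=> kn; under [X in inner _ _ X]funext do rewrite OPUC_combE.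
rewrite (@inner_sumr _ mu n (phi k) c phi) //.
rewrite (bigD1 (Ordinal kn)) //= inner_phi eqxx mul1r big1 ?addr0 // => i ik.
rewrite inner_phi (_ : (k == i) = false) ?mul0r ?mulr0 //.
by apply: contra_neqF ik => /eqP ki; exact/val_inj.
Qed.

Lemma inner_OPUC_comb_self n c :
  circle_int mu (fun z => `|(OPUC_comb n c).[z]| ^+ 2) =
  \sum_(k < n) `|c k| ^+ 2 * kappa k.
Proof.
have sH := square_integrable_horner mu (OPUC_comb n c).
rewrite -inner_normsq.
have HE : (fun z => (OPUC_comb n c).[z]) = (fun z => \sum_(i < n) c i * phi i z).
  by apply/funext => z; rewrite OPUC_combE.
rewrite [X in inner _ _ X]HE (@inner_sumr _ mu n _ c phi) //.
apply: eq_bigr => i _; rewrite -inner_conj // inner_OPUC_comb // rmorphM.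
by rewrite /= OPUC_norm_conj mulrA -normCK.
Qed.

(** The remainder [r] of [f] after projection to the span of the first [n] polynomials is orthogonal
    to the projection [H], so [<r, r>] is [<f, f>] minus the sum. *)
Lemma bessel f n : square_integrable mu f ->
  \sum_(k < n) `|inner mu (phi k) f| ^+ 2 / kappa k <= inner mu f f.
Proof.
move=> sf; pose c k := inner mu (phi k) f / kappa k.
pose H := OPUC_comb n c.
have sH := square_integrable_horner mu H.
have sNH : square_integrable mu (fun z => -1 * H.[z]).
  by have := square_integrable_horner mu (- H);
    under eq_fun do rewrite hornerN -mulN1r.
pose r z := f z + -1 * H.[z].
have sr : square_integrable mu r by exact: square_integrableD.
have rphi k : (k < n)%N -> inner mu r (phi k) = 0.
  move=> kn; rewrite -inner_conj // innerDr // innerZr // inner_OPUC_comb //.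
  by rewrite mulfVK ?lt0r_neq0 ?OPUC_norm_gt0 // mulN1r subrr conjC0.
have HE : (fun z => H.[z]) = (fun z => \sum_(i < n) c i * phi i z).
  by apply/funext => z; rewrite OPUC_combE.
have rH : inner mu r (fun z => H.[z]) = 0.
  rewrite HE (@inner_sumr _ mu n _ c phi) // big1 // => i _.
  by rewrite rphi ?mulr0.
have := inner_ge0 mu r; rewrite {2}/r innerDr // innerZr // rH mulr0 addr0.
rewrite -inner_conj // innerDr // innerZr // rmorphD /= inner_conj //.
have fH : inner mu f (horner H) = \sum_(i < n) c i * inner mu f (phi i).
  by rewrite -(inner_sumr n c sf sphi) -HE.
rewrite fH mulN1r rmorphN /= subr_ge0.
congr (_ <= _); rewrite rmorph_sum; apply: eq_bigr => i _ /=.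
rewrite -[inner mu f _]inner_conj // rmorphM /= conjCK rmorphM fmorphV /=.
by rewrite OPUC_norm_conj normCK; ring.
Qed.

End Bessel.

(** * Regularization of the integral [J] *)

Section JIntegral.
Variable R : realType.
Local Notation C := R[i].
Local Notation unit_circle := (@circle R : set (borelC R)).
Local Open Scope classical_set_scope.
Variable mu : probability (borelC R) R.

(** The integrand of [J] with [1 / (k + 1)] added to its denominator: bounded for each [k], and
    increasing in [k] to the integrand, so that monotone convergence applies. *)
Definition J_reg (k : nat) (z : C) : C := (`|z - 1| ^+ 2 + k.+1%:R^-1)^-1.

Definition J_eintegrand (z : borelC R) : \bar R :=
  (if (z : C) == 1%R then +oo else (complex.Re (J_integrand z))%:E)%E.

Lemma Re_J_reg k z : complex.Re (J_reg k z) =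
  (Normc.normc (z - 1) ^+ 2 + k.+1%:R^-1)^-1.
Proof.
suff -> : J_reg k z = ((Normc.normc (z - 1) ^+ 2 + k.+1%:R^-1)^-1)%:C by [].
by rewrite fmorphV rmorphD /= rmorphXn /= fmorphV /= rmorph_nat.
Qed.

Lemma J_reg_den_gt0 k z : 0 < (`|z - 1| ^+ 2 + k.+1%:R^-1 : C).
Proof. by rewrite ltr_wpDl ?exprn_ge0 // invr_gt0 ltr0n. Qed.

Lemma cintegrable_J_reg k : cintegrable mu (J_reg k).
Proof.
have mJ : cmeasurable (J_reg k).
  apply: cmeasurableV; apply: cmeasurableD; last exact: cmeasurable_cst.
  apply: cmeasurable_normsq; apply: cmeasurableD; first exact: cmeasurable_id.
  exact: cmeasurable_cst.
apply: (le_cintegrable mJ (cintegrable_cst mu k.+1%:R)) => z _.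
rewrite ger0_norm ?invr_ge0 ?(ltW (J_reg_den_gt0 _ _)) //.
rewrite -[leRHS]invrK lef_pV2 ?posrE ?J_reg_den_gt0 ?invr_gt0 ?ltr0n //.
by rewrite lerDr exprn_ge0.
Qed.

(* The limit at [z = 1] is [+oo], so an atom at 1 is seen by the limit. *)
Lemma J_reg_cvg z : circle z ->
  (complex.Re (J_reg k z))%:E @[k --> \oo] --> J_eintegrand z.
Proof.
move=> z1; under eq_fun do rewrite Re_J_reg.
rewrite /J_eintegrand; case: eqVneq => [->|zn1].
  rewrite subrr Normc.normc0 expr0n.
  under eq_fun do rewrite add0r invrK.
  by apply/cvgeryP; rewrite (cvg_shiftS (fun n => n%:R : R)); exact: cvgr_idn.
rewrite J_integrandE //.
have -> : complex.Re ((`|z - 1| ^+ 2)^-1) = (Normc.normc (z - 1) ^+ 2 + 0)^-1.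
  rewrite addr0 -[LHS]/(complex.Re (((Normc.normc (z - 1))%:C ^+ 2)^-1)).
  by rewrite -rmorphXn -fmorphV.
apply: cvg_EFin; first by near=> k.
apply: cvgV; last first.
  by apply: cvgD; [exact: cvg_cst|exact: cvg_harmonic].
rewrite addr0 sqrf_eq0; apply: contra_neq zn1 => /Normc.eq0_normc/eqP.
by rewrite subr_eq0 => /eqP.
Unshelve. all: by end_near. Qed.

Lemma measurable_J_reg k :
  measurable_fun unit_circle (fun z => (complex.Re (J_reg k z))%:E).
Proof. by case: (cintegrable_J_reg k) => /measurable_int. Qed.

Lemma J_reg_ge0 k z : (0 <= (complex.Re (J_reg k z))%:E)%E.
Proof.
by rewrite Re_J_reg lee_fin invr_ge0 addr_ge0 ?sqr_ge0 // invr_ge0 ler0n.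
Qed.

Lemma J_reg_homo z :
  {homo (fun k => (complex.Re (J_reg k z))%:E) : n m / (n <= m)%N >-> (n <= m)%E}.
Proof.
move=> n m nm; rewrite !Re_J_reg lee_fin /=.
have pos k : 0 < Normc.normc (z - 1) ^+ 2 + k.+1%:R^-1.
  by rewrite ltr_wpDl ?sqr_ge0 // invr_gt0 ltr0n.
by rewrite lef_pV2 ?posrE // lerD2l lef_pV2 ?posrE ?ltr0n // ler_nat.
Qed.

Lemma measurable_J_eintegrand : measurable_fun unit_circle J_eintegrand.
Proof.
apply: (emeasurable_fun_cvg
  (fun k (z : borelC R) => (complex.Re (J_reg k z))%:E)).
  exact: measurable_J_reg.
by move=> z; exact: J_reg_cvg.
Qed.

Lemma J_cvg :
  (\int[mu]_(z in unit_circle) (complex.Re (J_reg k z))%:E)%E @[k --> \oo]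
    --> J mu.
Proof.
have -> : J mu = (\int[mu]_(z in unit_circle)
    limn (fun k => (complex.Re (J_reg k z))%:E))%E.
  apply: eq_integral => z; rewrite inE => z1; apply/esym/cvg_lim => //.
  exact: J_reg_cvg.
apply: (cvg_monotone_convergence (@measurable_circle R)).
- exact: measurable_J_reg.
- by move=> k z _; exact: J_reg_ge0.
- by move=> z _; exact: J_reg_homo.
Qed.

Lemma J_le (M : R) : (forall k, circle_int mu (J_reg k) <= M%:C) ->
  J_exists mu.
Proof.
move=> JM; apply: (@le_lt_trans _ _ M%:E); last exact: ltry.
have cJ := J_cvg; rewrite -(cvg_lim _ cJ) //.
apply: lime_le; first by apply/cvg_ex; eexists; exact: cJ.
apply: nearW => k; have [iJ _] := cintegrable_J_reg k.
have := JM k; rewrite /circle_int lecE /= => /andP[_].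
rewrite /Rintegral -lee_fin fineK // integrable_fin_num //.
exact: measurable_circle.
Qed.

End JIntegral.

(** * The kernel [1 / (z - 1)] when [J] is finite *)

Section JExists.
Variable R : realType.
Local Notation C := R[i].
Local Notation unit_circle := (@circle R : set (borelC R)).
Local Open Scope classical_set_scope.
Variable mu : probability (borelC R) R.
Hypothesis Jmu : J_exists mu.

Lemma J_exists_integrable : mu.-integrable unit_circle (@J_eintegrand R).
Proof.
apply/integrableP; split; first exact: measurable_J_eintegrand.
rewrite (eq_integral (@J_eintegrand R)) // => z; rewrite inE => z1.
rewrite gee0_abs // /J_eintegrand; case: eqVneq => // zn1.
rewrite J_integrandE // lee_fin.
have : 0 <= (`|(z : C) - 1| ^+ 2)^-1 by rewrite invr_ge0 exprn_ge0.
by rewrite lecE => /andP[].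
Qed.

(** Its value at 1 is 0 by the convention on inverses; a finite [J] makes that point null. *)
Definition cauchy1 (z : C) : C := (z - 1)^-1.

Lemma cmeasurable_cauchy1 : cmeasurable cauchy1.
Proof.
apply: cmeasurableV; apply: cmeasurableD; first exact: cmeasurable_id.
exact: cmeasurable_cst.
Qed.

(** Away from 1 its squared modulus is the integrand of [J], which dominates it at 1 as well, being
    infinite there. *)
Lemma square_integrable_cauchy1 : square_integrable mu cauchy1.
Proof.
have mh := cmeasurable_cauchy1; split=> //.
have [mR mI] := cmeasurable_normsq mh.
have E z : `|cauchy1 z| ^+ 2 = (Normc.normc (cauchy1 z) ^+ 2)%:C.
  by rewrite rmorphXn.
have iJ := J_exists_integrable; have mc := @measurable_circle R.
split; apply: (le_integrable mc _ _ iJ).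
- exact/measurable_EFinP.
- move=> z z1; rewrite /J_eintegrand; case: eqVneq => [_|zn1]; first exact: leey.
  by rewrite J_integrandE // /cauchy1 normfV exprVn.
- exact/measurable_EFinP.
- by move=> z _; rewrite E /= normr0 abse_ge0.
Qed.

(** The factors cancel except at 1, and 1 is not an atom: an integrable function is finite almost
    everywhere, while the integrand of [J] is infinite at 1. *)
Lemma circle_int_cauchy1 (p : {poly C}) :
  circle_int mu (fun z => p.[z] * ((z - 1) * cauchy1 z)) =
  circle_int mu (fun z => p.[z]).
Proof.
have mc := @measurable_circle R.
have [mp _] := square_integrable_horner mu p.
have [mpR mpI] := mp.
have [mqR mqI] : cmeasurable (fun z => p.[z] * ((z - 1) * cauchy1 z)).
  apply: cmeasurableM => //; apply: cmeasurableM cmeasurable_cauchy1.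
  by apply: cmeasurableD; [exact: cmeasurable_id|exact: cmeasurable_cst].
have ae1 : {ae mu, forall z : borelC R, unit_circle z -> (z : C) != 1}.
  apply: filterS (integrable_ae mc J_exists_integrable) => z h /h.
  by rewrite /J_eintegrand; case: eqVneq.
have ae_p : {ae mu, forall z : borelC R, unit_circle z ->
    p.[z] * (((z : C) - 1) * cauchy1 z) = p.[z]}.
  apply: filterS ae1 => z h /h zn1.
  by rewrite /cauchy1 mulfV ?mulr1 // subr_eq0.
rewrite /circle_int /Rintegral; congr (fine _ +i* fine _);
  apply: ae_eq_integral => //; try exact/measurable_EFinP;
  by apply: filterS ae_p => z h /h ->.
Qed.

End JExists.

(** * Finiteness of [J] and boundedness of Wall's sums *)

Section JDichotomy.
Variable R : realType.
Local Notation C := R[i].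
Variables (alpha : nat -> C) (mu : probability (borelC R) R).
Variable S : nat -> {poly C}.
Hypothesis halpha : forall n, `|alpha n| < 1.
Hypothesis hmu : nontrivial_prob mu.
Hypothesis hS : monic_OPUC mu S.
Hypothesis hverb : forall n : nat, verblunsky alpha n = - ((S n).[0])^*%R.
Local Notation kappa := (OPUC_norm alpha).
Local Notation P rho0 n := (\prod_(k < n) (mpar alpha rho0 k.+1 /
                  (1 - mpar alpha rho0 k.+1))).

Lemma J_exists_bounded_sum : J_exists mu -> exists rho0 : C,
  [/\ `|rho0| = 1, rho0 != 1 & exists B, forall n, \sum_(k < n) P rho0 k <= B].
Proof.
move=> Jmu; have [mu1 _] := hmu.
have sh := square_integrable_cauchy1 Jmu.
pose K (p : {poly C}) := circle_int mu (fun z => p.[z] * cauchy1 z).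
have iK p : cintegrable mu (fun z => p.[z] * cauchy1 z).
  exact: square_integrableM (square_integrable_horner mu p) sh.
have KD p q : K (p + q) = K p + K q.
  by rewrite /K -circle_intD //; apply: eq_circle_int => z _; rewrite hornerD mulrDl.
have KZ c p : K (c *: p) = c * K p.
  by rewrite /K -circle_intZ //; apply: eq_circle_int => z _; rewrite hornerZ mulrA.
(* Multiplication by [z] changes [K] only by the integral of [p], which is zero for [S n.+1]; hence
   the Szego recurrence passes to [K] as its specialization at [z = 1]. *)
have KX p : K ('X * p) = K p + circle_int mu (fun z => p.[z]).
  have i1 := iK ('X * p); have i2 := cintegrableZ (-1) (iK p).
  apply/eqP; rewrite addrC -subr_eq -mulN1r; apply/eqP.
  rewrite -(circle_int_cauchy1 Jmu) /K -circle_intZ // -circle_intD //.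
  by apply: eq_circle_int => z _; rewrite hornerM hornerX; ring.
pose u n := K ('X * S n); pose v n := K (revp n (S n)).
have int_S n : circle_int mu (fun z => (S n.+1).[z]) = 0.
  have := OPUC_orthogonal hmu hS (p := 1) (n := n.+1).
  rewrite size_poly1 => /(_ isT) <-; apply: eq_circle_int => z _.
  by rewrite hornerC conjC1 mul1r.
have uS n : u n.+1 = u n - (alpha n)^*%R * v n.
  rewrite /u KX int_S addr0 (szego_recurrence hmu hS hverb).
  by rewrite -scaleNr KD KZ mulNr.
have vS n : v n.+1 = v n - alpha n * u n.
  by rewrite /v (szego_recurrence_revp hmu hS hverb) -scaleNr KD KZ mulNr.
have conj_h z : circle z -> (cauchy1 z)^*%R = - (z * cauchy1 z).
  move=> z1; rewrite /cauchy1 fmorphV rmorphB rmorph1 /=.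
  have -> : (z^*)%R = z^-1.
    by rewrite -[RHS]mulr1 -(circle_conj z1) mulKf // circle_neq0.
  have z0 := circle_neq0 z1.
  have -> : z^-1 - 1 = - (z^-1 * (z - 1)) by field.
  by rewrite invrN invfM invrK.
(* Up to sign and conjugation [u n] is thus a Fourier coefficient of [cauchy1], to which Bessel's
   inequality applies. *)
have uE n : u n = - (inner mu (fun z => (S n).[z]) (@cauchy1 R))^*%R.
  have sS := square_integrable_horner mu (S n).
  rewrite inner_conj // -mulN1r /inner -circle_intZ; last first.
    exact: square_integrableM (square_integrable_conj sh) sS.
  apply: eq_circle_int => z z1; rewrite conj_h // hornerM hornerX. ring.
have uv1 : u 0 - v 0 = 1.
  rewrite /u KX /v (revp_OPUC0 hS) (OPUC0 hS) addrAC subrr add0r.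
  under eq_fun do rewrite hornerC.
  exact: circle_int_cst.
(* This gives equal moduli, and with [u 0 - v 0 = 1] it excludes [v 0 = 0]; the quotient [u 0 / v 0]
   is then an admissible [rho0]. *)
have uv0 : u 0 = - (v 0)^*%R.
  rewrite uE /v (revp_OPUC0 hS) (OPUC0 hS) /inner /K; congr (- _^*%R).
  by apply: eq_circle_int => z _; rewrite hornerC conjC1.
have nuv : `|u 0| = `|v 0| by rewrite uv0 normrN norm_conjC.
have v0 : v 0 != 0.
  apply/eqP => v0; move: uv1 => /eqP.
  by rewrite uv0 v0 conjC0 oppr0 addr0 eq_sym oner_eq0.
have uv_neq1 : u 0 / v 0 != 1.
  rewrite -subr_eq0 -[X in _ - X](mulfV v0) -mulrBl uv1 mul1r invr_eq0 //.
exists (u 0 / v 0); split=> //.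
  by rewrite normrM normfV nuv mulfV // normr_eq0.
(* The terms [|v 0|^2 P_k] equal [|u_k|^2 / ||S_k||^2], the terms of Bessel's inequality, so its
   bound is divided by [|v 0|^2]. *)
pose B := inner mu (@cauchy1 R) (@cauchy1 R) / `|v 0| ^+ 2.
exists (complex.Re B) => n.
suff : (\sum_(k < n) P (u 0 / v 0) k)%:C <= B by rewrite lecE => /andP[].
have nv0 : 0 < `|v 0| ^+ 2 by rewrite exprn_gt0 // normr_gt0.
rewrite /B ler_pdivlMr //; apply: le_trans (bessel halpha hmu hS hverb n sh).
rewrite rmorph_sum mulr_suml ler_sum // => k _ /=.
rewrite mulrC -(normsq_solution halpha uS vS nuv v0 uv_neq1).
by rewrite -(norm_solution halpha uS vS nuv v0) uE normrN norm_conjC.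
Qed.

Lemma bounded_sum_J_exists (rho0 : C) (B : R) : `|rho0| = 1 -> rho0 != 1 ->
  (forall n, \sum_(k < n) P rho0 k <= B) -> J_exists mu.
Proof.
move=> rho0_1 rho0_neq1 hB; have [mu1 _] := hmu.
(* The solution with [u_n = rho_n v_n]; the first factor normalizes it to [u 0 - v 0 = 1]. *)
pose v n := (rho0 - 1)^-1 * \prod_(k < n) (1 - rho alpha rho0 k * alpha k).
pose u n := rho alpha rho0 n * v n.
have vS' n : v n.+1 = v n * (1 - rho alpha rho0 n * alpha n).
  by rewrite /v big_ord_recr /= mulrA.
have vS n : v n.+1 = v n - alpha n * u n by rewrite vS' /u; ring.
have uS n : u n.+1 = u n - (alpha n)^*%R * v n.
  rewrite /u vS' /=; have := one_sub_rho_neq0 halpha rho0_1 n.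
  by move: (rho alpha rho0 n) (v n) => r x h; field.
have r1 : rho0 - 1 != 0 by rewrite subr_eq0.
have v0 : v 0 != 0 by rewrite /v big_ord0 mulr1 invr_eq0.
have uv1 : u 0 - v 0 = 1.
  by rewrite /u /v big_ord0 mulr1 /=; field.
have u0E : u 0 / v 0 = rho0 by rewrite /u mulfK.
have nuv : `|u 0| = `|v 0| by rewrite /u normrM rho0_1 mul1r.
have nu n : `|u n| = `|v n| by rewrite /u normrM norm_rho // mul1r.
have PE n : `|v n| ^+ 2 / kappa n = `|v 0| ^+ 2 * (P rho0 n)%:C.
  by rewrite -u0E; apply: normsq_solution; rewrite ?u0E.
clearbody u v.
have kappa_gt0 n : 0 < kappa n := OPUC_norm_gt0 halpha n.
pose H n := OPUC_comb S n (fun k => (u k)^*%R / kappa k).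
pose G n := (kappa n)^-1 *: ((v n)^*%R *: revp n (S n) - (u n)^*%R *: S n).
(* The Christoffel-Darboux identity by telescoping: [1 - z] times the next term of [H] is the
   increment of [G], and the normalization gives [G 0 = -1]. *)
have HG n : (1 - 'X) * H n = 1 + G n.
  elim: n => [|n ih].
    rewrite /H /OPUC_comb big_ord0 mulr0 /G /OPUC_norm big_ord0 invr1 scale1r.
    rewrite (revp_OPUC0 hS) (OPUC0 hS) -scalerBl -rmorphB -opprB uv1.
    by rewrite rmorphN rmorph1 scaleN1r subrr.
  rewrite /H /OPUC_comb big_ord_recr /= mulrDr -/(OPUC_comb S n _) -/(H n) ih.
  rewrite -addrA; congr (_ + _).
  rewrite /G uS vS (szego_recurrence_revp hmu hS hverb).
  rewrite (szego_recurrence hmu hS hverb) /OPUC_norm big_ord_recr /= -/(kappa n).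
  have := lt0r_neq0 (one_sub_normsq_gt0 halpha n); rewrite normCK => a0.
  have k0 := lt0r_neq0 (kappa_gt0 n).
  move: (u n) (v n) => x y.
  rewrite mulrBl mul1r -scalerAr !rmorphB !rmorphM /= conjCK.
  apply/polyP => i; rewrite !(coefB, coefD, coefZ).
  by field; rewrite a0 k0.
(* Since [|u_n| = |v_n|] and [S n] and its reversal have the same norm, the two terms of [G n]
   contribute equally. *)
have nG n : circle_int mu (fun z => `|(G n).[z]| ^+ 2) <=
    4 * `|v 0| ^+ 2 * (P rho0 n)%:C.
  have sS := square_integrable_horner mu (S n).
  have sT := square_integrable_horner mu (revp n (S n)).
  have iS := cintegrableZ (2 * `|v n| ^+ 2 / kappa n ^+ 2) sS.2.
  have iT := cintegrableZ (2 * `|v n| ^+ 2 / kappa n ^+ 2) sT.2.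
  have -> : 4 * `|v 0| ^+ 2 * (P rho0 n)%:C = circle_int mu (fun z =>
      2 * `|v n| ^+ 2 / kappa n ^+ 2 * `|(revp n (S n)).[z]| ^+ 2 +
      2 * `|v n| ^+ 2 / kappa n ^+ 2 * `|(S n).[z]| ^+ 2).
    rewrite -mulrA -PE circle_intD // !circle_intZ; [|exact: sS.2|exact: sT.2].
    rewrite (OPUC_norm_revp hmu hS hverb) -inner_normsq (OPUC_normE hmu hS hverb).
    by move: (`|v n| ^+ 2) (kappa n) (lt0r_neq0 (kappa_gt0 n)) => x y h; field.
  apply: le_circle_int.
  - exact: (square_integrable_horner mu (G n)).2.
  - exact: cintegrableD.
  move=> z _; rewrite /G !(hornerZ, hornerD, hornerN) normrM exprMn normfV.
  rewrite (gtr0_norm (kappa_gt0 n)).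
  have -> : 2 * `|v n| ^+ 2 / kappa n ^+ 2 * `|(revp n (S n)).[z]| ^+ 2 +
      2 * `|v n| ^+ 2 / kappa n ^+ 2 * `|(S n).[z]| ^+ 2 = (kappa n)^-1 ^+ 2 *
      (2 * `|(v n)^*%R * (revp n (S n)).[z]| ^+ 2 +
       2 * `|- ((u n)^*%R * (S n).[z])| ^+ 2).
    rewrite normrN !normrM !norm_conjC nu !exprMn exprVn.
    by have := lt0r_neq0 (kappa_gt0 n) => h; field.
  by rewrite ler_wpM2l ?le_normsqD // exprn_ge0 // invr_ge0 ltW.
have nH n : circle_int mu (fun z => `|(H n).[z]| ^+ 2) <= `|v 0| ^+ 2 * B%:C.
  rewrite (inner_OPUC_comb_self halpha hmu hS hverb).
  have -> : \sum_(k < n) `|(u k)^*%R / kappa k| ^+ 2 * kappa k =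
      `|v 0| ^+ 2 * (\sum_(k < n) P rho0 k)%:C.
    rewrite rmorph_sum mulr_sumr; apply: eq_bigr => k _ /=.
    rewrite -PE normrM norm_conjC nu normfV (gtr0_norm (kappa_gt0 k)).
    by have := lt0r_neq0 (kappa_gt0 k) => h; field.
  by rewrite ler_wpM2l ?exprn_ge0 // lecR.
pose V : R := Normc.normc (v 0) ^+ 2.
have VE : `|v 0| ^+ 2 = V%:C by rewrite rmorphXn.
have V0 : 0 <= V by exact: sqr_ge0.
(* The first term of this bound comes from [H n]; the 1 covers [G n] once [n] is chosen in terms of
   [k]. *)
apply: (@J_le _ mu (2 * V * B + 1)) => k.
(* If [c P_n > 1] held for every [n], summing [N] terms would give [N <= c B], against the choice of
   [N]. *)
have [n Pn] : exists n, 8 * V * k.+1%:R * P rho0 n <= 1.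
  apply: contrapT => nP.
  pose c := 8 * V * k.+1%:R; have c0 : 0 <= c.
    by apply: mulr_ge0 (ler0n _ _); exact: mulr_ge0 (ler0n _ 8) V0.
  have B0 : 0 <= B by have := hB 0; rewrite big_ord0.
  have := archi_boundP (mulr_ge0 c0 B0); apply/negP; rewrite -leNgt.
  set N := Num.bound _.
  apply: (le_trans _ (ler_wpM2l c0 (hB N))); rewrite mulr_sumr.
  rewrite -[X in X%:R](card_ord N) -sumr_const ler_sum // => i _.
  by apply/ltW; rewrite ltNge; apply/negP => h; apply: nP; exists i.
have nH2 := cintegrableZ 2 (square_integrable_horner mu (H n)).2.
have nG2 := cintegrableZ (2 * k.+1%:R) (square_integrable_horner mu (G n)).2.
(* With [d = 1 / (k + 1)], the identity [1 = |(1 - z) H_n - G_n|^2] gives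
   [1 <= 2 |1 - z|^2 |H_n|^2 + 2 |G_n|^2], which is at most [(2 |H_n|^2 + 2 |G_n|^2 / d) (|z - 1|^2
   + d)]. *)
have le_reg : circle_int mu (J_reg k) <=
    circle_int mu (fun z =>
      2 * `|(H n).[z]| ^+ 2 + 2 * k.+1%:R * `|(G n).[z]| ^+ 2).
  apply: le_circle_int; [exact: cintegrable_J_reg|exact: cintegrableD|].
  move=> z _; have d0 := @J_reg_den_gt0 R k z.
  have HG1 : `|(1 - z) * (H n).[z] - (G n).[z]| ^+ 2 = 1.
    have := congr1 (fun p => p.[z]) (HG n).
    rewrite hornerM !(hornerD, hornerN, hornerC, hornerX) => ->.
    by rewrite addrK normr1 expr1n.
  rewrite -[J_reg k z]mul1r ler_pdivrMr // -[X in X <= _]HG1.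
  apply: (le_trans (le_normsqD _ _)); rewrite normrN normrM distrC exprMn.
  have k0 : k.+1%:R != 0 :> C by rewrite pnatr_eq0.
  rewrite -subr_ge0.
  move: (exprn_ge0 2 (normr_ge0 (z - 1))) (exprn_ge0 2 (normr_ge0 (H n).[z])).
  move: (exprn_ge0 2 (normr_ge0 (G n).[z])).
  move: (`|z - 1| ^+ 2) (`|(H n).[z]| ^+ 2) (`|(G n).[z]| ^+ 2) => a b c c0 a0 b0.
  have -> : (2 * b + 2 * k.+1%:R * c) * (a + k.+1%:R^-1) - (2 * (a * b) + 2 * c)
      = 2 * b / k.+1%:R + 2 * k.+1%:R * c * a by field.
  by rewrite addr_ge0 // !mulr_ge0 ?invr_ge0 ?ler0n.
apply: (le_trans le_reg).
rewrite circle_intD // !circle_intZ; last 2 first.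
- exact: (square_integrable_horner mu (G n)).2.
- exact: (square_integrable_horner mu (H n)).2.
have h2 : 0 <= 2 * k.+1%:R :> C by rewrite mulr_ge0 ?ler0n.
apply: le_trans (lerD (ler_wpM2l (ler0n C 2) (nH n)) (ler_wpM2l h2 (nG n))) _.
have -> : 2 * (`|v 0| ^+ 2 * B%:C) +
      2 * k.+1%:R * (4 * `|v 0| ^+ 2 * (P rho0 n)%:C)
    = (2 * V * B + 8 * V * k.+1%:R * P rho0 n)%:C.
  rewrite VE [RHS]rmorphD !(rmorphM (real_complex R)) /= !rmorph_nat; ring.
by rewrite lecR lerD2l.
Qed.

End JDichotomy.

Theorem theorem4p1 (R : realType) (alpha : nat -> R[i])
    (mu : probability (borelC R) R) (Sn : nat -> {poly R[i]})
    (halpha : forall n : nat, `|alpha n| < 1)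
    (hmu : nontrivial_prob mu)
    (hS : monic_OPUC mu Sn)
    (hverb : forall n : nat, verblunsky alpha n = - ((Sn n).[0])^*%R) :
  (forall (rho0 : R[i]) (Rn : nat -> {poly R[i]}),
     `|rho0| = 1 -> rho0 != 1 ->
     Rn 0%N = 1 ->
     (forall n : nat, (1 <= n)%N ->
        (\prod_(k < n)
           ((1 + complex.Re (rho alpha rho0 k * verblunsky alpha k))%:C
            / (1 + (rho alpha rho0 k)^*%R * (verblunsky alpha k)^*%R))) *: Rn n
        = 'X * Sn n.-1 - rho alpha rho0 n.-1 *: revp n.-1 (Sn n.-1)) ->
     (forall n : nat, (1 <= n)%N -> para_orthogonal Sn n (Rn n)) /\
     (exists c : nat -> R,
        [/\ (c 1%N)%:C = (0 +i* 1) * ((rho0 + 1) / (rho0 - 1)),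
            forall n : nat, (1 <= n)%N ->
              c n.+1 = - complex.Im (rho alpha rho0 n * verblunsky alpha n)
                       / (1 + complex.Re (rho alpha rho0 n * verblunsky alpha n)),
            Rn 1%N = (1 +i* c 1%N) *: 'X + (1 -i* c 1%N)%:P &
            forall n : nat, (1 <= n)%N ->
              Rn n.+1 = ((1 +i* c n.+1) *: 'X + (1 -i* c n.+1)%:P) * Rn n
                       - (4 * d1 alpha rho0 n)%:C *: ('X * Rn n.-1)]) /\
     positive_chain_seq (d1 alpha rho0) /\
     minimal_parameter_seq (d1 alpha rho0) (mpar alpha rho0)) /\
  (J_exists mu <->
     exists rho0 : R[i],
       [/\ `|rho0| = 1, rho0 != 1 & ~ SPPCS (d1 alpha rho0)]).
Proof.
split=> [rho0 Rn rho0_1 rho0_neq1 Rn0 hR|].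
  split=> [n|].
    exact: (para_orthogonal_POPUC halpha rho0_1 rho0_neq1 hR).
  have mm := mpar_minimal halpha rho0_1 rho0_neq1.
  split; last by split=> //; case: mm => pm _; exists (mpar alpha rho0).
  exists (ttrr_c alpha rho0); split.
  - exact: ttrr_c1E.
  - by case.
  - exact: (ttrr1 halpha hS rho0_1 rho0_neq1 hR).
  - exact: (ttrr halpha hmu hS hverb rho0_1 rho0_neq1 Rn0 hR).
split=> [/(J_exists_bounded_sum halpha hmu hS hverb)|].
  move=> [rho0 [rho0_1 rho0_neq1 hB]]; exists rho0; split=> //.
  exact/(not_SPPCS_iff (mpar_minimal halpha rho0_1 rho0_neq1)).
move=> [rho0 [rho0_1 rho0_neq1]].
move/(not_SPPCS_iff (mpar_minimal halpha rho0_1 rho0_neq1)) => [B hB].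
exact: (bounded_sum_J_exists halpha hmu hS hverb rho0_1 rho0_neq1 hB).
Qed.
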